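(* Let $G_1,G_2,G_3$ be critical snarks, and for each $i\in\{1,2,3\}$ let $e_i$ be an edge and $w_i$ a vertex of $G_i$ (not an endvertex of $e_i$) such that the $(2,3)$-pole $T_i=(G_i-e_i)-w_i$ is proper, perfect and good. Then the graph $H_6*\operatorname{TTT}_{\mathrm{sc}}(T_1,T_2,T_3)$ is a strictly critical snark.
   Context: Snarks: a snark is a connected cubic graph with chromatic index $4$; it is critical if removing any two distinct adjacent vertices yields a $3$-edge-colourable graph, bicritical if removing any two distinct vertices yields a $3$-edge-colourable graph, and strictly critical if critical but not bicritical. Multipoles: a multipole is a graph that may contain dangling edges (edges with only one end incident with a vertex) and isolated edges (edges with no end incident with a vertex); an edge end not incident with a vertex is a semiedge. All multipoles here are cubic (every vertex is incident with exactly three edge ends). The semiedges are partitioned into linearly ordered connectors; a multipole with connectors of widths $k_1,\dots,k_t$ is a $(k_1,\dots,k_t)$-pole. A junction of two semiedges joins them into one edge; a junction of two connectors of equal width joins their semiedges pairwise in order. For a graph/multipole $G$ and a vertex $v$, $G-v$ denotes the multipole obtained by deleting $v$ and turning its three incident edges into dangling edges (their free ends forming a new connector); for a link (edge with both ends at vertices) $e$, $G-e$ denotes the multipole obtained by cutting $e$ into two dangling edges forming a new $2$-connector. Thus $(G-e)-v$ is a $(2,3)$-pole $T(B,C)$ with $B$ the two semiedges from $e$ and $C$ the three semiedges from $v$. For a vertex $v$ incident with exactly one dangling edge, $M\sim v$ denotes the multipole obtained by deleting that dangling edge and suppressing $v$. Colourings: let $\mathbb{K}=\mathbb{Z}_2\times\mathbb{Z}_2\setminus\{(0,0)\}$.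 A colouring of a multipole assigns elements of $\mathbb{K}$ to edges so that the three edge ends at each vertex have colours summing to $0$ (equivalently, pairwise distinct). For a colouring $\varphi$ and a connector $S$, the flow through $S$ is $\varphi_*(S)=\sum_{e\in S}\varphi(e)$. A multipole is proper if $\varphi_*(S)\neq 0$ for every colouring $\varphi$ and every connector $S$. The colouring set $\operatorname{Col}(M)$ is the set of tuples of colours of the semiedges (listed connector by connector) over all colourings. A proper $(2,3)$-pole $T(B,C)$ is perfect if $\operatorname{Col}(T)$ contains every tuple $(x_1,x_2,y_1,y_2,y_3)\in\mathbb{K}^5$ with $x_1+x_2\neq 0$, $y_1+y_2+y_3\neq0$ and $x_1+x_2+y_1+y_2+y_3=0$. Essential and good: a pair $\{e,f\}$ of distinct edges of a snark $G$ is essential if $G-e-f$ (the graph with both edges deleted) is $3$-edge-colourable and for every vertex $v$ of the $4$-pole $G-(e,f)$ incident with a dangling edge, the $3$-pole $(G-(e,f))\sim v$ is colourable. A proper $(2,3)$-pole $T=(G-e)-v$ is good if for every endvertex $w$ of $e$ and every pair of edges $f,g$ with $f$ incident with $w$ and $g$ incident with $v$, the pair $\{f,g\}$ is essential in $G$. Constructions: for $(2,3)$-poles $T_i(B_i,C_i)$, $i=1,2,3$, $\operatorname{TTT}_{\mathrm{sc}}(T_1,T_2,T_3)$ is the $(2,2,2)$-pole with connectors $B_1,B_2,B_3$ obtained from $T_1\cup T_2\cup T_3$ by adding three new vertices $v_1,v_2,v_3$ and attaching the three dangling edges of each $C_i$ to $v_1,v_2,v_3$, one to each. $H_6$ is the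 $(2,2,2)$-pole consisting of a $6$-cycle $u_1u_2u_3u_4u_5u_6$ with a dangling edge $e_j$ attached to $u_j$ for each $j$, with connectors $(e_1,e_4),(e_2,e_5),(e_3,e_6)$. $H_6*\operatorname{TTT}_{\mathrm{sc}}(T_1,T_2,T_3)$ is the cubic graph obtained by joining the $i$-th connector of $H_6$ with $B_i$ for $i=1,2,3$. *)

(* Defs.v *)
From HB Require Import structures.
From mathcomp Require Import all_boot all_algebra.

Set Implicit Arguments.
Unset Strict Implicit.
Unset Printing Implicit Defensive.

Import GRing.Theory.
Local Open Scope ring_scope.

(* A multipole has vertices [vset], a subset of an ambient finite type V, and
   edge ends [ends], a subset of an ambient finite type D.  An edge is the pair
   {x, mate x}; [inc x] is the vertex with which the end x is incident, and
   inc x = None when x is a semiedge.  Loops, parallel edges, dangling edges and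
   isolated edges are thus all allowed.  The values of [mate] and [inc] outside
   [ends] are irrelevant.  [conns] is the list of connectors. *)
Record multipole (V D : finType) := Multipole {
  vset : {set V};
  ends : {set D};
  mate : D -> D;
  inc : D -> option V;
  conns : seq (seq D)
}.

Section Basics.
Variables (V D : finType) (M : multipole V D).

Definition semiedges : {set D} := [set x in ends M | inc M x == None].

Definition ends_at (v : V) : {set D} := [set x in ends M | inc M x == Some v].

Definition well_formed : Prop :=
  [/\ forall x, x \in ends M ->
        [/\ mate M x \in ends M, mate M x != x & mate M (mate M x) = x],
      forall x v, x \in ends M -> inc M x = Some v -> v \in vset M,
      uniq (flatten (conns M)),
      flatten (conns M) =i semiedges
    & [::] \notin conns M].

Definition cubic : Prop := forall v, v \in vset M -> #|ends_at v| = 3%N.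

Definition adjacent : rel V :=
  [rel u v | [exists x in ends M,
                (inc M x == Some u) && (inc M (mate M x) == Some v)]].

Definition connected : Prop :=
  vset M != set0 /\ {in vset M &, forall u v, connect adjacent u v}.

(* Two distinct ends at a common vertex must get different colours; in
   particular a loop cannot be coloured.  Vertices may have any valency. *)
Definition edge_colourable (k : nat) : Prop :=
  exists c : D -> nat,
    [/\ {in ends M, forall x, (c x < k)%N},
        {in ends M, forall x, c (mate M x) = c x}
      & forall v, {in ends_at v &, injective c}].

Definition chromatic_index (k : nat) : Prop :=
  edge_colourable k /\ forall j, (j < k)%N -> ~ edge_colourable j.

Definition del_vertices (U : {set V}) : multipole V D :=
  let gone x := if inc M x is Some v then v \in U else false in
  let A := [set x in ends M | ~~ gone x & ~~ gone (mate M x)] in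
  Multipole (vset M :\: U) A (mate M) (inc M)
    [seq q <- [seq [seq x <- q | x \in A] | q <- conns M] | q != [::]].

Definition del_edge (x : D) : multipole V D :=
  let A := ends M :\: [set x; mate M x] in
  Multipole (vset M) A (mate M) (inc M)
    [seq q <- [seq [seq y <- q | y \in A] | q <- conns M] | q != [::]].

Definition snark : Prop :=
  [/\ well_formed, semiedges = set0, cubic, connected & chromatic_index 4].

End Basics.

Section Criticality.
Variables (V D : finType) (G : multipole V D).

Definition critical : Prop :=
  forall u v, u \in vset G -> v \in vset G -> u != v -> adjacent G u v ->
    edge_colourable (del_vertices G [set u; v]) 3.

Definition bicritical : Prop :=
  forall u v, u \in vset G -> v \in vset G -> u != v ->
    edge_colourable (del_vertices G [set u; v]) 3.

Definition critical_snark : Prop := snark G /\ critical.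

Definition strictly_critical_snark : Prop :=
  [/\ snark G, critical & ~ bicritical].

End Criticality.

(* The colours are the nonzero elements of Z_2 x Z_2. *)
Definition colour : Type := ('Z_2 * 'Z_2)%type.

Section Colourings.
Variables (V D : finType) (M : multipole V D).

Definition colouring (phi : D -> colour) : Prop :=
  [/\ {in ends M, forall x, phi x != 0},
      {in ends M, forall x, phi (mate M x) = phi x}
    & {in vset M, forall v, \sum_(x in ends_at M v) phi x = 0}].

Definition colourable : Prop := exists phi, colouring phi.

Definition flow (phi : D -> colour) (q : seq D) : colour :=
  \sum_(x <- q) phi x.

Definition proper_pole : Prop :=
  forall phi, colouring phi ->
    forall q, q \in conns M -> flow phi q != 0.

Definition Col (t : seq colour) : Prop :=
  exists2 phi, colouring phi & t = map phi (flatten (conns M)).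

Definition perfect : Prop :=
  forall x1 x2 y1 y2 y3 : colour,
    [/\ x1 != 0, x2 != 0, y1 != 0, y2 != 0 & y3 != 0] ->
    x1 + x2 != 0 -> y1 + y2 + y3 != 0 -> x1 + x2 + y1 + y2 + y3 = 0 ->
    Col [:: x1; x2; y1; y2; y3].

End Colourings.

(* M - v: the ends incident with v become semiedges; s lists them in the order
   chosen for the new connector. *)
Definition sub_vertex (V D : finType) (M : multipole V D) (v : V) (s : seq D) :
    multipole V D :=
  Multipole (vset M :\ v) (ends M) (mate M)
    (fun x => if inc M x == Some v then None else inc M x)
    (rcons (conns M) s).

(* M - e for the edge e = {x, mate x}: the edge is cut into {x, inr false} and
   {mate x, inr true}, and the new 2-connector is (inr false, inr true). *)
Definition sub_edge (V D : finType) (M : multipole V D) (x : D) :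
    multipole V _ :=
  Multipole (vset M)
    [set z : D + bool | if z is inl y then y \in ends M else true]
    (fun z => match z with
              | inl y => if y == x then inr false
                         else if y == mate M x then inr true
                         else inl (mate M y)
              | inr b => inl (if b then mate M x else x)
              end)
    (fun z => if z is inl y then inc M y else None)
    (rcons (map (map inl) (conns M)) [:: inr false; inr true]).

Definition dangling_at (V D : finType) (M : multipole V D) (v : V) : {set D} :=
  [set x in ends_at M v | inc M (mate M x) == None].

(* M ~ v, for a vertex v incident with exactly one dangling edge.  If x is the
   other end of an edge leading to v, then the new mate of x is the other end
   of the second non-dangling edge at v. *)
Definition smooth (V D : finType) (M : multipole V D) (v : V) :
    multipole V D :=
  let A := [set x in ends M | inc M x != Some v
                            & mate M x \notin dangling_at M v] in
  Multipole (vset M :\ v) A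
    (fun x => if inc M (mate M x) == Some v then
                if [pick z in ends_at M v :\: dangling_at M v
                      | z != mate M x] is Some z
                then mate M z else mate M x
              else mate M x)
    (inc M)
    [seq q <- [seq [seq x <- q | x \in A] | q <- conns M] | q != [::]].

Section Essential.
Variables (V D : finType) (G : multipole V D).

(* The pair of the edges {x, mate x} and {y, mate y}.  The multipole N ~ v is
   only meaningful at vertices with exactly one dangling edge.  The 4-pole of a
   snark has a vertex with two dangling edges only if the two edges are
   adjacent, in which case the first condition already fails. *)
Definition essential (x y : D) : Prop :=
  [/\ [/\ x \in ends G, y \in ends G, y != x & y != mate G x],
      edge_colourable (del_edge (del_edge G x) y) 3
    & let N := sub_edge (sub_edge G x) (inl y) in
      forall v, v \in vset N -> #|dangling_at N v| = 1%N ->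
        colourable (smooth N v)].

(* (G - e) - v being good, with e = {x, mate x}; f and g are represented by
   their ends f, g at an endvertex of e and at v. *)
Definition good (x : D) (v : V) : Prop :=
  forall f g : D, f \in ends G -> g \in ends G ->
    (inc G f == inc G x) || (inc G f == inc G (mate G x)) ->
    inc G g = Some v -> g != f -> g != mate G f ->
    essential f g.

(* (G - e) - v, with e = {x, mate x} and s an ordering of the ends at v *)
Definition pole23 (x : D) (v : V) (s : seq D) :
    multipole V _ :=
  sub_vertex (sub_edge G x) v (map inl s).

End Essential.

(* The j-th semiedge of the second connector of each T i is attached to the
   j-th new vertex. *)
Definition TTTsc (V D : 'I_3 -> finType) (T : forall i, multipole (V i) (D i)) :
    multipole _ _ :=
  let B i := nth [::] (conns (T i)) 0 in
  let C i := nth [::] (conns (T i)) 1 in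
  Multipole
    [set u : {i : 'I_3 & V i} + 'I_3 |
       if u is inl a then tagged a \in vset (T (tag a)) else true]
    [set x : {i : 'I_3 & D i} | tagged x \in ends (T (tag x))]
    (fun x => Tagged D (mate (T (tag x)) (tagged x)))
    (fun x => if inc (T (tag x)) (tagged x) is Some v then
                Some (inl (Tagged V v))
              else if tagged x \in C (tag x) then
                Some (inr (inord (index (tagged x) (C (tag x)))))
              else None)
    [seq [seq Tagged D x | x <- B i] | i <- enum 'I_3].

(* Vertex j of the 6-cycle has the ends (j, (true, true)) and
   (j, (true, false)) towards j + 1 and j - 1, and the end (j, (false, false))
   of its dangling edge, whose semiedge is (j, (false, true)). *)
Definition H6 : multipole _ _ :=
  Multipole [set _ : 'I_6 | true] [set _ : 'I_6 * (bool * bool) | true]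
    (fun x : 'I_6 * (bool * bool) =>
       let: (j, (c, b)) := x in
       if c then ((if b then ordS j else ord_pred j), (true, ~~ b))
       else (j, (false, ~~ b)))
    (fun x => let: (j, (c, b)) := x in if ~~ c && b then None else Some j)
    [seq [:: (inord k, (false, true)); (inord (k + 3)%N, (false, true))]
       | k <- iota 0 3].

Definition disjoint_union (V1 D1 V2 D2 : finType)
    (M : multipole V1 D1) (N : multipole V2 D2) :
    multipole _ _ :=
  Multipole
    [set u : V1 + V2 |
       match u with inl a => a \in vset M | inr a => a \in vset N end]
    [set x : D1 + D2 |
       match x with inl a => a \in ends M | inr a => a \in ends N end]
    (fun x => match x with inl a => inl (mate M a) | inr a => inr (mate N a) end)
    (fun x => match x with
              | inl a => omap inl (inc M a)
              | inr a => omap inr (inc N a)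
              end)
    (map (map inl) (conns M) ++ map (map inr) (conns N)).

(* Junction of the semiedges p.1 and p.2 of M *)
Definition junction (V D : finType) (M : multipole V D) (p : D * D) :
    multipole V D :=
  let A := ends M :\: [set p.1; p.2] in
  Multipole (vset M) A
    [fun x => mate M x with mate M p.1 |-> mate M p.2,
                            mate M p.2 |-> mate M p.1]
    (inc M)
    [seq q <- [seq [seq x <- q | x \in A] | q <- conns M] | q != [::]].

(* M * N: junction of the i-th connectors of M and N for all i, when the
   connectors of M and N have the same widths. *)
Definition compose (V1 D1 V2 D2 : finType)
    (M : multipole V1 D1) (N : multipole V2 D2) :
    multipole _ _ :=
  foldl (@junction _ _) (disjoint_union M N)
    (zip (map inl (flatten (conns M))) (map inr (flatten (conns N)))).

(* Main.v *)
Require Import Defs.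
From mathcomp Require Import all_boot all_algebra.

(* A colouring is a nowhere-zero flow with values in Z_2 x Z_2, and deleting
   vertices from a cubic graph leaves a 3-edge-colourable graph iff the graph
   has a nowhere-zero assignment satisfying Kirchhoff's law at all the other
   vertices.

   The hexagon has no colouring in which its three pairs of opposite spokes all
   have nonzero flow.  Since the poles T_i are proper, no assignment can satisfy
   Kirchhoff's law everywhere except possibly at the new vertices v_k; hence the
   graph is not 3-edge-colourable, and removing v_1 and v_2 does not make it so.

   For criticality, let u, v be adjacent.  The two other poles are perfect, so
   they can be coloured as soon as the flow prescribed by the hexagon is nonzero
   and a 3 x 3 array of colours (poles against new vertices) has been completed.
   The pole that contains u or v is coloured by criticality of G_i (u, v in T_i,
   or u in T_i and v new: then both halves of e_i get the same colour), or by the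
   essential pair consisting of e_i and an edge at w_i (u in T_i and v in the
   hexagon). *)

Set Implicit Arguments.
Unset Strict Implicit.
Unset Printing Implicit Defensive.

Import GRing.Theory.

(** * Colours and the hexagon *)

Section Colours.
Local Open Scope ring_scope.

(** Parity governs every gluing. Unless a new vertex is removed, the flow leaving the pole treated
    by hand at its vertex [w i] and the flows through the connectors of the other two poles must add
    up to 0. Hence each existence lemma on the hexagon supplies an equation on flows along with its
    colours, and the completion of the array asks either for an exempt column or for that equation.
    Finite searches show that nothing else stands in the way.

    The delicate case is a removed spoke, where pole and hexagon constrain each other: the pole
    dictates the colour of one spoke, the hexagon that of the other. The circle is broken because
    the colour [delta] dictated by the pole does not depend on the colour received by the half of
    [e i] at the removed vertex, so [delta] can be fixed first.

    Connectedness is not a matter of gluing alone, since nothing says that a pole stays connected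
    after cutting; it is deduced from perfection. *)

Lemma addcc (x : colour) : x + x = 0.
Proof. by apply/eqP; case: x => -[[|[|//]] ?] [[|[|//]] ?]. Qed.

Lemma addc_eq0 (x y : colour) : (x + y == 0) = (x == y).
Proof. by rewrite -(inj_eq (addIr y)) -addrA addcc addr0 add0r. Qed.

Definition code (x : colour) : nat := (x.1 + 2 * x.2).-1.
Definition decode (n : nat) : colour := nth 0 [:: (1, 0); (0, 1); (1, 1)] n.

Lemma code_lt3 x : (code x < 3)%N.
Proof. by case: x => -[[|[|//]] ?] [[|[|//]] ?]. Qed.

Lemma codeK (x : colour) : x != 0 -> decode (code x) = x.
Proof.
by case: x => -[[|[|//]] ?] [[|[|//]] ?] // _; apply/eqP.
Qed.

Lemma decode_neq0 n : (n < 3)%N -> decode n != 0.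
Proof. by case: n => [|[|[|]]]. Qed.

Lemma decodeK n : (n < 3)%N -> code (decode n) = n.
Proof. by case: n => [|[|[|]]]. Qed.

(* The finite searches below are run on [bool * bool], which computes faster
   than ['Z_2 * 'Z_2]. *)
Notation bcolour := (bool * bool)%type.
Definition emb (x : bcolour) : colour := ((x.1 : nat)%:R, (x.2 : nat)%:R).
Definition badd (x y : bcolour) : bcolour := (x.1 (+) y.1, x.2 (+) y.2).
Definition bnz (x : bcolour) := x.1 || x.2.
Definition bcolours : seq bcolour := [:: (false, true); (true, false); (true, true)].
Definition bnth : seq bcolour -> nat -> bcolour := nth (false, false).

Lemma embD x y : emb (badd x y) = emb x + emb y.
Proof. by apply/eqP; case: x y => [[] []] [[] []]. Qed.

Lemma emb_eq0 x : (emb x == 0) = ~~ bnz x.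
Proof. by case: x => [[] []]. Qed.

Lemma embP (x : colour) : x != 0 -> exists2 y, y \in bcolours & x = emb y.
Proof.
by case: x => -[[|[|//]] ?] [[|[|//]] ?] // _;
  [exists (false, true)|exists (true, false)|exists (true, true)] => //; apply/eqP.
Qed.

Lemma bcolours_neq0 x : x \in bcolours -> emb x != 0.
Proof. by rewrite emb_eq0; case: x => [[] []]. Qed.

Lemma emb_eq x y : (emb x == emb y) = ~~ bnz (badd x y).
Proof. by rewrite -addc_eq0 -embD emb_eq0. Qed.

Lemma sum3_distinct (x y z : colour) :
  x != 0 -> y != 0 -> z != 0 -> x != y -> x != z -> y != z -> x + y + z = 0.
Proof.
move=> /embP[a ha ->] /embP[b hb ->] /embP[c hc ->]; rewrite !emb_eq.
move: a b c ha hb hc => [[] []] [[] []] [[] []] // _ _ _ _ _ _; exact/eqP.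
Qed.

(** Here [a], ..., [f] are the edges of the hexagon in cyclic order, and each spoke is the sum of
    its two neighbours. In terms of the sums [a + d], [b + e], [c + f] of opposite edges, the three
    flows are their pairwise sums, so the claim is that two of these sums agree. *)
Lemma hexagon_flow (a b c d e f : colour) :
  [/\ a != 0, b != 0 & c != 0] -> [/\ d != 0, e != 0 & f != 0] ->
  [/\ a + f != 0, b + a != 0 & c + b != 0] ->
  [/\ d + c != 0, e + d != 0 & f + e != 0] ->
  [|| a + f + (d + c) == 0, b + a + (e + d) == 0 | c + b + (f + e) == 0].
Proof.
move=> [/embP[{}a ha ->] /embP[{}b hb ->] /embP[{}c hc ->]].
move=> [/embP[{}d hd ->] /embP[{}e he ->] /embP[{}f hf ->]].
rewrite -!embD !emb_eq0 => -[h1 h2 h3] [h4 h5 h6].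
suff : all (fun a => all (fun b => all (fun c => all (fun d => all (fun e =>
   all (fun f => [&& ~~ ~~ bnz (badd a f), ~~ ~~ bnz (badd b a), ~~ ~~ bnz (badd c b),
     ~~ ~~ bnz (badd d c), ~~ ~~ bnz (badd e d) & ~~ ~~ bnz (badd f e)] ==>
    [|| ~~ bnz (badd (badd a f) (badd d c)), ~~ bnz (badd (badd b a) (badd e d))
      | ~~ bnz (badd (badd c b) (badd f e))])
   bcolours) bcolours) bcolours) bcolours) bcolours) bcolours.
  move=> /allP/(_ a ha)/allP/(_ b hb)/allP/(_ c hc)/allP/(_ d hd)/allP/(_ e he).
  by move=> /allP/(_ f hf)/implyP-> //; rewrite h1 h2 h3 h4 h5.
by vm_compute.
Qed.

(** Each orbit [{x, f x}] contributes twice the same colour, which is 0. Comparing ranks selects one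
    element per orbit, and [f] exchanges the two halves. *)
Lemma sum_involution (D : finType) (f : D -> D) (X : {set D}) (phi : D -> colour) :
    {in X, forall x, [/\ f x \in X, f x != x & f (f x) = x]} ->
    {in X, forall x, phi (f x) = phi x} ->
  \sum_(x in X) phi x = 0.
Proof.
move=> hf hphi.
rewrite (bigID (fun x => (enum_rank x < enum_rank (f x))%N)) /=.
set S := (X in X + _); set S' := (X in _ + X); suff -> : S' = S by exact: addcc.
rewrite /S /S' (reindex_onto f f) /=; last first.
  by move=> x /andP[/hf[]].
apply: eq_big => [x|x /andP[/andP[hx _] /eqP ffx]]; last first.
  by have [hx1 _ _] := hf _ hx; rewrite ffx in hx1; rewrite hphi.
apply/idP/idP => [/andP[/andP[hx h] /eqP ffx]|/andP[hx h]].
  have [hx1 n1 _] := hf _ hx; rewrite ffx in hx1 n1; rewrite hx1 /=.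
  rewrite ffx -leqNgt leq_eqVlt in h; case/orP: h => // /eqP h.
  by case/eqP: n1; apply: enum_rank_inj; apply: val_inj.
by have [-> _ ->] := hf _ hx; rewrite eqxx andbT -leqNgt ltnW.
Qed.

Definition triples : seq (seq bcolour) :=
  [seq x :: s | x <- bcolours,
                s <- [seq [:: y; z] | y <- bcolours, z <- bcolours]].

Lemma mem_triples x y z : x \in bcolours -> y \in bcolours -> z \in bcolours ->
  [:: x; y; z] \in triples.
Proof. by case: x y z => [[] []] [[] []] [[] []]. Qed.

Lemma triplesP s k : s \in triples -> (k < 3)%N -> bnth s k \in bcolours.
Proof.
case/allpairsP=> -[x t] [hx ht ->]; case/allpairsP: ht => -[y z] [/= hy hz ->] /=.
by case: k => [|[|[|]]].
Qed.

Lemma size_triples s : s \in triples -> size s = 3%N.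
Proof.
by case/allpairsP=> -[x t] [_ ht ->]; case/allpairsP: ht => -[y z] [_ _ ->].
Qed.

(** The column [k] is exempt from summing to 0, and [k = 3] encodes that no column is. In the latter
    case the sum of all entries has to vanish, which is the last hypothesis. *)
Lemma complete_rows3 (k : nat) (y0 y1 y2 a b : colour) :
    (k <= 3)%N -> [/\ y0 != 0, y1 != 0 & y2 != 0] -> a != 0 -> b != 0 ->
    (k < 3)%N || (y0 + y1 + y2 + a + b == 0) ->
  exists z t : seq bcolour, [/\ z \in triples, t \in triples,
     emb (bnth z 0) + emb (bnth z 1) + emb (bnth z 2) = a,
     emb (bnth t 0) + emb (bnth t 1) + emb (bnth t 2) = b
   & forall j, (j < 3)%N -> j != k ->
       nth 0 [:: y0; y1; y2] j + emb (bnth z j) + emb (bnth t j) = 0].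
Proof.
pose sum3 z := badd (badd (bnth z 0) (bnth z 1)) (bnth z 2).
move=> hk [/embP[x0 h0 ->] /embP[x1 h1 ->] /embP[x2 h2 ->]].
move=> /embP[{}a ha ->] /embP[{}b hb ->]; rewrite -!embD emb_eq0 => hs.
suff : all (fun k => all (fun y => all (fun a => all (fun b =>
    ((k < 3)%N || ~~ bnz (badd (badd (sum3 y) a) b)) ==>
    has (fun z => ~~ bnz (badd (sum3 z) a) && has (fun t =>
      ~~ bnz (badd (sum3 t) b) && all (fun j => (j == k) ||
         ~~ bnz (badd (badd (bnth y j) (bnth z j)) (bnth t j)))
      (iota 0 3)) triples) triples) bcolours) bcolours) triples) (iota 0 4).
  move=> /allP/(_ k); rewrite mem_iota => /(_ hk)/allP/(_ _ (mem_triples h0 h1 h2)).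
  move=> /allP/(_ a ha)/allP/(_ b hb)/implyP/(_ hs).
  case/hasP=> z hz /andP[za /hasP[t ht /andP[tb /allP hj]]].
  exists z, t; split=> // [||j hj3 jk].
  - by apply/eqP; rewrite -!embD emb_eq.
  - by apply/eqP; rewrite -!embD emb_eq.
  have := hj j; rewrite mem_iota (negPf jk) => /(_ hj3) /=.
  rewrite -emb_eq0 !embD => /eqP <-; rewrite (_ : nth _ _ _ = emb (bnth [:: x0; x1; x2] j)) //.
  by case: j hj3 {jk} => [|[|[|]]].
by vm_compute.
Qed.

(** The connector [i] of the hexagon consists of the opposite spokes at [i] and [i + 3]; [b] tells
    which half of the cut edge of pole [i] is joined there. *)
Definition pole_index (i : 'I_3) (b : bool) : 'I_6 := inord (i + 3 * b).

Lemma val_pole_index i b : pole_index i b = (i + 3 * b)%N :> nat.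
Proof. by rewrite inordK //; case: i b => [[|[|[|//]]] ?] [|]. Qed.

Definition sextuples : seq (seq bcolour) := [seq s ++ t | s <- triples, t <- triples].

(** The entry [k] of [hs] colours the edge from vertex [k] to its successor, so the entry [k + 5]
    modulo 6 belongs to the edge arriving at [k]. *)
Definition hex_sum (hs : seq bcolour) (k : nat) : bcolour :=
  badd (bnth hs k) (bnth hs ((k + 5) %% 6)).

(* The value at a vertex with zero sum is a junk nonzero colour. *)
Definition hex_spoke (hs : seq bcolour) (k : nat) : bcolour :=
  let x := hex_sum hs k in if bnz x then x else (false, true).

Definition hex_flow (hs : seq bcolour) (i : nat) : bcolour :=
  badd (hex_spoke hs i) (hex_spoke hs (i + 3)).

Definition hex_ok (U : pred nat) (hs : seq bcolour) :=
  all (fun k => U k || bnz (hex_sum hs k)) (iota 0 6).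

(** Carries a list found by search over to assignments on ['I_6]: [h j] is the edge from [j] to
    [ordS j], and [d j] the spoke at [j]. The condition [hex_ok] keeps the junk value of a spoke
    confined to the defects [U]. *)
Lemma hex_colouring (U : pred nat) (hs : seq bcolour) :
    hs \in sextuples -> hex_ok U hs ->
  exists h d : 'I_6 -> colour, [/\ forall j, h j != 0, forall j, d j != 0,
     forall j : 'I_6, ~~ U j -> h j + h (ord_pred j) + d j = 0,
     forall i b, d (pole_index i b) = emb (hex_spoke hs (i + 3 * b))
   & forall i, d (pole_index i false) + d (pole_index i true) =
       emb (hex_flow hs i)].
Proof.
move=> hhs ok; exists (emb \o bnth hs), (emb \o hex_spoke hs); split=> [j|j|j Uj|i b|i] /=.
- apply: bcolours_neq0; case/allpairsP: hhs => -[s t] [/= hs1 ht ->].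
  rewrite /bnth nth_cat (size_triples hs1); case: ltnP => hj; apply: triplesP => //.
  by rewrite ltn_subLR.
- by rewrite emb_eq0 negbK /hex_spoke; case: ifP.
- have := allP ok j; rewrite mem_iota (negPf Uj) /= ltn_ord => /(_ isT) h.
  by rewrite /hex_spoke h /hex_sum embD /= addnS addcc.
- by rewrite val_pole_index.
- by rewrite /hex_flow embD !val_pole_index addn0.
Qed.

(** Serves the removal of an edge of the hexagon. With two defects the vanishing of the total flow
    is no longer automatic, and it has to be part of the search. *)
Lemma hex_adjacent (j : 'I_6) :
  exists h d : 'I_6 -> colour, [/\ forall k, h k != 0, forall k, d k != 0,
     forall k, k != j -> k != ordS j -> h k + h (ord_pred k) + d k = 0,
     forall i, d (pole_index i false) + d (pole_index i true) != 0
   & \sum_(i < 3) (d (pole_index i false) + d (pole_index i true)) = 0].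
Proof.
suff /allP/(_ (j : nat)) : all (fun j => has (fun hs =>
    [&& hex_ok (fun k => (k == j) || (k == j.+1 %% 6)%N) hs,
        all (fun i => bnz (hex_flow hs i)) (iota 0 3)
      & ~~ bnz (badd (hex_flow hs 0) (badd (hex_flow hs 1) (hex_flow hs 2)))])
    sextuples) (iota 0 6).
  rewrite mem_iota => /(_ (ltn_ord j))/hasP[hs hhs /and3P[ok /allP fl sum0]].
  have [h [d [h0 d0 hd _ dE]]] := hex_colouring hhs ok.
  exists h, d; split=> // [k kj ksj|i|].
  - by apply: hd; rewrite negb_or; apply/andP; split.
  - by rewrite dE emb_eq0 negbK; apply: fl; rewrite mem_iota /=.
  - by apply/eqP; rewrite !big_ord_recl big_ord0 addr0 !dE -!embD emb_eq0.
by vm_compute.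
Qed.

Lemma hex_sum_others (hs : seq bcolour) (i : 'I_3) x :
  x + \sum_(i' < 3 | i' != i) emb (hex_flow hs i') =
  x + emb (foldr (fun i' => if i' != i :> nat then badd (hex_flow hs i') else id)
         (false, false) (iota 0 3)).
Proof.
congr (_ + _); rewrite big_mkcond !big_ord_recl big_ord0 /= -val_eqE /=.
by case: i => [[|[|[|//]]] ?] /=; rewrite !embD !add0r.
Qed.

(** Serves the removal of a spoke. The colour [x] plays two roles: it is the colour of the opposite
    spoke, and also the flow that pole [i], having lost a vertex, sends to the new vertices; hence
    its appearance in the sum. The spoke at the defect is left free. *)
Lemma hex_one_defect (i : 'I_3) (b : bool) (x : colour) : x != 0 ->
  exists h d : 'I_6 -> colour, [/\ forall k, h k != 0, forall k, d k != 0,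
     forall k, k != pole_index i b -> h k + h (ord_pred k) + d k = 0,
     d (pole_index i (~~ b)) = x
   & (forall i', i' != i ->
        d (pole_index i' false) + d (pole_index i' true) != 0) /\
     x + \sum_(i' < 3 | i' != i)
       (d (pole_index i' false) + d (pole_index i' true)) = 0].
Proof.
case/embP=> {}x hx ->; have hb : b \in [:: true; false] by case: b.
suff /allP/(_ (i : nat)) : all (fun i : nat => all (fun b : bool => all (fun x =>
   has (fun hs =>
    [&& hex_ok (pred1 (i + 3 * b)%N) hs,
        ~~ bnz (badd (hex_spoke hs (i + 3 * ~~ b)) x),
        all (fun i' => (i' != i) ==> bnz (hex_flow hs i')) (iota 0 3)
      & ~~ bnz (badd x (foldr (fun i' => if i' != i then badd (hex_flow hs i') else id)
              (false, false) (iota 0 3)))])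
    sextuples) bcolours) [:: true; false]) (iota 0 3).
  rewrite mem_iota => /(_ (ltn_ord i))/allP/(_ b hb)/allP/(_ x hx).
  case/hasP=> hs hhs /and4P[ok dx /allP fl sum0].
  have [h [d [h0 d0 hd dE fE]]] := hex_colouring hhs ok.
  exists h, d; split=> //; last split.
  - by move=> k kj; apply: hd; rewrite /= -val_pole_index.
  - by apply/eqP; rewrite dE emb_eq.
  - move=> i' i'i; rewrite fE emb_eq0 negbK.
    by have := fl i'; rewrite mem_iota ltn_ord => /(_ isT)/implyP; apply.
  - under eq_bigr => i' _ do rewrite fE.
    by apply/eqP; rewrite hex_sum_others -embD emb_eq0.
by vm_compute.
Qed.

(** Serves the poles coloured by criticality: [e i] is then an intact edge of [G i] and passes one
    colour to both of its halves. This zero flow through connector [i] is what makes a hexagon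
    without defects possible. *)
Lemma hex_equal_spokes (i : 'I_3) (x : colour) : x != 0 ->
  exists h d : 'I_6 -> colour, [/\ forall k, h k != 0, forall k, d k != 0,
     forall k, h k + h (ord_pred k) + d k = 0,
     forall b, d (pole_index i b) = x
   & (forall i', i' != i ->
        d (pole_index i' false) + d (pole_index i' true) != 0) /\
     \sum_(i' < 3 | i' != i)
       (d (pole_index i' false) + d (pole_index i' true)) = 0].
Proof.
case/embP=> {}x hx ->.
suff /allP/(_ (i : nat)) : all (fun i : nat => all (fun x => has (fun hs =>
    [&& hex_ok xpred0 hs, ~~ bnz (badd (hex_spoke hs i) x),
        ~~ bnz (badd (hex_spoke hs (i + 3)) x),
        all (fun i' => (i' != i) ==> bnz (hex_flow hs i')) (iota 0 3)
      & ~~ bnz (foldr (fun i' => if i' != i then badd (hex_flow hs i') else id)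
              (false, false) (iota 0 3))])
    sextuples) bcolours) (iota 0 3).
  rewrite mem_iota => /(_ (ltn_ord i))/allP/(_ x hx).
  case/hasP=> hs hhs /and5P[ok dx dx' /allP fl sum0].
  have [h [d [h0 d0 hd dE fE]]] := hex_colouring hhs ok.
  exists h, d; split=> //; last split.
  - by move=> k; apply: hd.
  - by case; apply/eqP; rewrite dE emb_eq ?addn0.
  - move=> i' i'i; rewrite fE emb_eq0 negbK.
    by have := fl i'; rewrite mem_iota ltn_ord => /(_ isT)/implyP; apply.
  - under eq_bigr => i' _ do rewrite fE.
    by apply/eqP; rewrite -[X in X == _]add0r hex_sum_others add0r emb_eq0.
by vm_compute.
Qed.

End Colours.

(** * Colourings with defects *)

Section ColouringOff.
Local Open Scope ring_scope.
Variables (V D : finType).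
Implicit Types (M : multipole V D) (U : {set V}) (phi : D -> colour).

(** Edges meeting [U] remain coloured; only Kirchhoff's law is dropped there. The ends of [M] thus
    stay the same for every [U], and parity arguments can run over the whole graph. *)
Definition colouring_off M U phi : Prop :=
  [/\ {in ends M, forall x, phi x != 0},
      {in ends M, forall x, phi (mate M x) = phi x}
    & forall v, v \in vset M -> v \notin U -> \sum_(x in ends_at M v) phi x = 0].

Lemma card3_set (T : finType) (A : {set T}) x y :
  #|A| = 3%N -> x \in A -> y \in A -> x != y ->
  exists z, [/\ z \in A, z != x, z != y & A = [set x; y; z]].
Proof.
move=> hA xA yA xy; have : #|A :\ x :\ y| = 1%N.
  have := cardsD1 y (A :\ x); rewrite !inE eq_sym xy yA add1n.
  by have := cardsD1 x A; rewrite xA hA add1n => -[<-] [<-].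
move/eqP/cards1P=> [z hz]; have : z \in A :\ x :\ y by rewrite hz inE.
rewrite !inE => /and3P[zy zx zA]; exists z; split=> //.
rewrite -(setD1K xA) -(@setD1K _ y (A :\ x)) ?hz ?setUA //.
by rewrite !inE eq_sym xy.
Qed.

Lemma sum_set3 (T : finType) (phi : T -> colour) x y z :
  x != y -> z != x -> z != y ->
  \sum_(t in [set x; y; z]) phi t = phi x + phi y + phi z.
Proof.
move=> xy zx zy; rewrite setUC big_setU1 ?inE ?negb_or ?zx ?zy //=.
by rewrite big_setU1 ?inE //= big_set1 addrC.
Qed.

Lemma sum_eq0_injective (T : finType) (A : {set T}) (phi : T -> colour) :
    #|A| = 3%N -> {in A, forall x, phi x != 0} -> \sum_(x in A) phi x = 0 ->
  {in A &, injective phi}.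
Proof.
move=> hA h0 hs x y xA yA xy; apply/eqP/negPn/negP=> nxy.
have [z [zA zx zy eA]] := card3_set hA xA yA nxy.
by move: hs (h0 _ zA); rewrite eA sum_set3 // xy addcc add0r => /eqP ->.
Qed.

Lemma injective_sum_eq0 (T : finType) (A : {set T}) (phi : T -> colour) :
    #|A| = 3%N -> {in A, forall x, phi x != 0} -> {in A &, injective phi} ->
  \sum_(x in A) phi x = 0.
Proof.
move=> hA h0 hi.
have /card_gt0P[x xA] : (0 < #|A|)%N by rewrite hA.
have /card_gt0P[y /[!inE] /andP[yx yA]] : (0 < #|A :\ x|)%N.
  by have := cardsD1 x A; rewrite xA hA add1n => -[<-].
rewrite eq_sym in yx.
have [z [zA zx zy eA]] := card3_set hA xA yA yx.
rewrite eA sum_set3 // sum3_distinct ?h0 ?(inj_in_eq hi) //.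
  by rewrite eq_sym.
by rewrite eq_sym.
Qed.

(** Greedy extension: as long as [B] is a proper part of [A], fewer than [n] colours are in use, so
    one is left for a further element. *)
Lemma extend_injection (T : finType) (A : {set T}) (B : {set T}) n (c : T -> nat) :
    (#|A| <= n)%N -> B \subset A -> {in B &, injective c} ->
    {in B, forall x, c x < n}%N ->
  exists c', [/\ {in A &, injective c'}, {in A, forall x, c' x < n}%N
               & {in B, c' =1 c}].
Proof.
move=> hA; have [m] := ubnP #|A :\: B|; elim: m => // m IH in B c * => hm BA ci cn.
have [AB|nAB] := boolP (A \subset B).
  have -> : A = B by apply/eqP; rewrite eqEsubset AB.
  by exists c.
have /subsetPn[x xA xB] := nAB.
have hB : (#|B| < n)%N.
  by apply: leq_trans hA; apply: proper_card; rewrite properE BA.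
have [k kn kB] : exists2 k, (k < n)%N & k \notin [seq c y | y in B].
  have : ~~ ([set: 'I_n] \subset [set k : 'I_n | val k \in [seq c y | y in B]]).
    apply: contraL hB => h; rewrite -leqNgt -{1}(card_ord n) -cardsT.
    apply: leq_trans (subset_leq_card h) _; rewrite -(size_image c B).
    rewrite cardE -(size_map val); apply: uniq_leq_size.
      by rewrite (map_inj_uniq val_inj) enum_uniq.
    by move=> k /mapP[i]; rewrite mem_enum inE => hi ->.
  by case/subsetPn=> k _; rewrite inE; exists k.
pose c1 y := if y == x then k else c y.
have c1B : {in B, c1 =1 c}.
  by move=> y yB; rewrite /c1; case: eqP xB => // <-; rewrite yB.
have [||||c' [c'i c'n c'c1]] := IH (x |: B) c1.
- have -> : A :\: (x |: B) = (A :\: B) :\ x.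
    by apply/setP=> y; rewrite !inE negb_or andbA.
  by move: hm; rewrite (cardsD1 x (A :\: B)) !inE xA xB add1n ltnS.
- by rewrite subUset sub1set xA.
- have kc y : y \in B -> k = c y -> False.
    by move=> yB ke; case/negP: kB; rewrite ke; apply: image_f.
  move=> y z; rewrite !inE => /orP[/eqP->|yB] /orP[/eqP->|zB] //.
  + by rewrite (c1B z zB) {1}/c1 eqxx => /(kc z zB).
  + by rewrite (c1B y yB) {1}/c1 eqxx => /esym/(kc y yB).
  + by rewrite !c1B //; apply: ci.
- move=> y; rewrite !inE => /orP[/eqP->|yB]; first by rewrite /c1 eqxx.
  by rewrite c1B // cn.
by exists c'; split=> // y yB; rewrite c'c1 ?c1B // inE yB orbT.
Qed.

(** The local part of being a snark, isolated so that it can be used for the composed graph before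
    that graph is known to be a snark. *)
Definition closed_cubic M : Prop :=
  [/\ forall x, x \in ends M ->
        [/\ mate M x \in ends M, mate M x != x & mate M (mate M x) = x],
      forall x v, x \in ends M -> inc M x = Some v -> v \in vset M,
      forall x, x \in ends M -> inc M x != None
    & cubic M].

Lemma colouring_off_edge_colourable M U phi :
  closed_cubic M -> colouring_off M U phi -> edge_colourable (del_vertices M U) 3.
Proof.
move=> [mM vM iM cM] [phi0 phim phis]; exists (fun x => code (phi x)); split.
- by move=> x _; apply: code_lt3.
- by move=> x; rewrite inE => /and3P[xM _ _]; rewrite phim.
- move=> v x y /[!inE] /andP[/and3P[xM nx _] /eqP ix] /andP[/and3P[yM _ _] /eqP iy].
  rewrite /= in ix iy; rewrite ix in nx.
  move=> /(congr1 decode); rewrite !codeK ?phi0 //.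
  apply: (@sum_eq0_injective _ (ends_at M v)); rewrite ?inE ?xM ?yM ?ix ?iy ?eqxx //.
  + exact/cM/vM/ix.
  + by move=> z /[!inE] /andP[zM _]; apply: phi0.
  + by apply: phis nx; apply: vM ix.
Qed.

(** An edge lost with [U] has at most one endvertex outside [U]. There the surviving colours extend
    to all three ends, and the lost edge takes the colour its end receives; an edge inside [U] gets
    an arbitrary colour. No two prescriptions can clash. *)
Lemma edge_colourable_colouring_off M U :
  closed_cubic M -> edge_colourable (del_vertices M U) 3 ->
  exists phi, colouring_off M U phi.
Proof.
move=> [mM vM iM cM] [c [c3 cm ci]].
set N := del_vertices M U in c3 cm ci.
have NM x : x \in ends N -> x \in ends M by rewrite inE => /andP[].
have ext v : exists f : D -> nat, v \in vset M ->
   [/\ {in ends_at M v &, injective f}, {in ends_at M v, forall x, f x < 3}%N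
    & {in ends_at N v, f =1 c}].
  have [vV|_] := boolP (v \in vset M); last by exists c.
  have [||||f hf] := @extend_injection _ (ends_at M v) (ends_at N v) 3 c.
  - by rewrite cM.
  - by apply/subsetP=> x; rewrite !inE => /andP[/and3P[-> _ _]].
  - exact: ci.
  - by move=> x; rewrite inE => /andP[/c3].
  - by exists f.
have [F hF] := fin_all_exists ext.
pose out x := if inc M x is Some v then v \notin U else false.
pose phi x : colour := if x \in ends N then decode (c x)
  else if out x then if inc M x is Some v then decode (F v x) else 0
  else if out (mate M x) then 
   if inc M (mate M x) is Some v then decode (F v (mate M x)) else 0
  else (1, 0).
have F3 x v : x \in ends M -> inc M x = Some v -> (F v x < 3)%N.
  move=> xM ix; have [_ h _] := hF v (vM _ _ xM ix); apply: h.
  by rewrite inE xM ix /=.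
have phi0 : {in ends M, forall x, phi x != 0}.
  move=> x xM; rewrite /phi; case: ifP => [/c3 h|_]; first exact: decode_neq0.
  have dec0 y : y \in ends M -> 
      (if inc M y is Some v then decode (F v y) else 0) != 0.
    move=> yM; case iy: (inc M y) (iM _ yM) => [v|//] _.
    exact/decode_neq0/F3.
  case: ifP => _; first exact: dec0.
  by case: ifP => _ //; apply: dec0; have [] := mM _ xM.
have mN x : x \in ends M -> (mate M x \in ends N) = (x \in ends N).
  move=> xM; have [mxM _ mmx] := mM _ xM.
  by rewrite !inE mmx mxM xM /= andbC.
have outN x : x \in ends M -> (x \in ends N) = out x && out (mate M x).
  move=> xM; have [mxM _ mmx] := mM _ xM; rewrite inE xM /= /out.
  by case: (inc M x) (iM _ xM) => // v _; case: (inc M (mate M x)) (iM _ mxM).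
exists phi; split=> // [x xM|v vV vU].
- have [mxM _ mmx] := mM _ xM; rewrite /phi mN // mmx.
  case: ifP => [xN|]; first by rewrite (cm x).
  by rewrite outN //; case: (out x); case: (out _).
have phiE x : x \in ends_at M v -> phi x = decode (F v x).
  rewrite inE => /andP[xM /eqP ix]; rewrite /phi /out ix vU.
  case: ifP => // xN; have [_ _ ->] := hF v vV => //.
  by rewrite inE xN /= ix.
have [Fi Fl _] := hF v vV.
apply: injective_sum_eq0; first exact: cM.
  by move=> x xv; rewrite phiE // decode_neq0 // Fl.
move=> x y xv yv; rewrite !phiE // => /(congr1 code).
by rewrite !decodeK ?Fl //; apply: Fi.
Qed.

(** Every edge is counted at both of its ends. The values may be zero, so the lemma also applies to
    an assignment supported on a part of the graph. *)
Lemma closed_parity M phi : closed_cubic M ->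
  {in ends M, forall x, phi (mate M x) = phi x} ->
  \sum_(v in vset M) \sum_(x in ends_at M v) phi x = 0.
Proof.
move=> [mM vM iM _] phim.
rewrite -[RHS](sum_involution (f := mate M) (X := ends M) _ phim); last first.
  by move=> x /mM.
rewrite (exchange_big_dep (mem (ends M))) /=; last by move=> v x _ /[!inE]/andP[].
apply: eq_bigr => x xM; case ix: (inc M x) (iM _ xM) => [v|//] _.
rewrite (big_pred1 v) // => u; rewrite inE xM ix /=.
apply/andP/eqP => [[_ /eqP[->]] //|->]; split=> //.
exact: vM ix.
Qed.

Lemma closed_adjacent_sym M : closed_cubic M -> symmetric (adjacent M).
Proof.
case=> [mM _ _ _].
have h u v : adjacent M u v -> adjacent M v u.
  case/existsP=> x /and3P[xG ix imx]; have [mxG _ mmx] := mM _ xG.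
  by apply/existsP; exists (mate M x); rewrite mxG mmx imx.
by move=> u v; apply/idP/idP; apply: h.
Qed.

Lemma snark_closed_cubic M : snark M -> closed_cubic M.
Proof.
case=> -[mM vM _ _ _] se cM _ _; split=> // x xM; apply/negP=> ix.
have : x \in semiedges M by rewrite inE xM.
by rewrite se inE.
Qed.

(** The two ends of a loop would need equal colours as an edge and different ones at their vertex,
    whereas a snark has a 4-edge-colouring. *)
Lemma snark_loopless M x : snark M -> x \in ends M -> inc M (mate M x) != inc M x.
Proof.
move=> sM xM; have [mM vM iM _] := snark_closed_cubic sM.
have [mxM nx _] := mM _ xM.
have [_ _ _ _ [[c [_ cm ci]] _]] := sM.
apply: contra nx => /eqP ix; case jx: (inc M x) (iM _ xM) => [v|//] _; apply/eqP.
by apply: (ci v); rewrite ?inE ?xM ?mxM ?ix ?jx ?eqxx ?cm.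
Qed.

Lemma snark_conns M : snark M -> conns M = [::].
Proof.
case=> -[_ _ _ fl nn] se _ _ _; rewrite se in fl.
case: (conns M) fl nn => [//|[|x q] s] fl; first by rewrite inE.
by have := fl x; rewrite !inE eqxx.
Qed.

End ColouringOff.

(** * The pole obtained from one snark *)

Section Pole.
Local Open Scope ring_scope.
Variables (V D : finType) (G : multipole V D) (e : D) (w : V) (s : seq D).
Hypotheses (hG : snark G) (he : e \in ends G) (hw : w \in vset G).
Hypotheses (ew : inc G e <> Some w) (mew : inc G (mate G e) <> Some w).
Hypothesis hs : perm_eq s (enum (ends_at G w)).

Let cG := snark_closed_cubic hG.

(** Colourings of the pole, with defects [U], written on the ends of [G] itself: [e] and [mate G e]
    stand for the two dangling halves and may disagree, and [w] carries no condition. *)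
Definition pole_colouring (U : {set V}) (phi : D -> colour) : Prop :=
  [/\ {in ends G, forall x, phi x != 0},
      {in ends G, forall x, x != e -> x != mate G e -> phi (mate G x) = phi x}
    & forall v, v \in vset G -> v != w -> v \notin U ->
        \sum_(x in ends_at G v) phi x = 0].

Lemma mateE x : x \in ends G ->
  [/\ mate G x \in ends G, mate G x != x & mate G (mate G x) = x].
Proof. by have [h _ _ _] := cG; apply: h. Qed.

Lemma eq_mate x y : x \in ends G -> y \in ends G -> (mate G x == y) = (x == mate G y).
Proof.
move=> xG yG; have [_ _ mx] := mateE xG; have [_ _ my] := mateE yG.
by apply/eqP/eqP => [<-|->].
Qed.

Lemma incP x : x \in ends G -> exists2 v, inc G x = Some v & v \in vset G.
Proof.
have [_ h1 h2 _] := cG => xG; case ix: (inc G x) (h2 _ xG) => [v|//] _.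
by exists v => //; apply: h1 ix.
Qed.

Lemma card_ends v : v \in vset G -> #|ends_at G v| = 3%N.
Proof. by have [_ _ _ h] := cG; apply: h. Qed.

Lemma ends_at_w_ne x : x \in ends_at G w -> x != e /\ x != mate G e.
Proof.
rewrite inE => /andP[_ /eqP ix]; split; apply/eqP=> xe.
  by apply: ew; rewrite -xe.
by apply: mew; rewrite -xe.
Qed.

Lemma mem_s x : (x \in s) = (x \in ends_at G w).
Proof. by rewrite (perm_mem hs) mem_enum. Qed.

Lemma uniq_s : uniq s.
Proof. by rewrite (perm_uniq hs) enum_uniq. Qed.

Lemma size_s : size s = 3%N.
Proof. by rewrite (perm_size hs) -cardE card_ends. Qed.

Lemma sum_s (y : D -> colour) : \sum_(x <- s) y x = \sum_(x in ends_at G w) y x.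
Proof. by rewrite (perm_big _ hs) big_enum. Qed.

Lemma pole_conns :
  conns (pole23 G e w s) = [:: [:: inr false; inr true]; map inl s].
Proof. by rewrite /pole23 /= (snark_conns hG). Qed.

Lemma ends_at_pole v : v != w ->
  ends_at (pole23 G e w s) v = [set inl x | x in ends_at G v].
Proof.
move=> vw; apply/setP=> -[x|b]; rewrite !inE /=; last first.
  by symmetry; apply/imsetP=> -[].
rewrite (mem_imset _ _ (@inl_inj _ _)) inE; congr (_ && _).
case: (inc G x =P Some w) => // ->; symmetry; apply/eqP=> -[wv].
by rewrite wv eqxx in vw.
Qed.

Lemma sum_ends_at_pole v (psi : D + bool -> colour) : v != w ->
  \sum_(x in ends_at (pole23 G e w s) v) psi x = \sum_(x in ends_at G v) psi (inl x).
Proof. by move=> vw; rewrite ends_at_pole // big_imset //; apply: in2W inl_inj. Qed.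

Lemma pole_proper phi : proper_pole (pole23 G e w s) -> pole_colouring set0 phi ->
  phi e + phi (mate G e) != 0.
Proof.
move=> hp [phi0 phim phis].
pose psi (z : D + bool) :=
  match z with inl x => phi x | inr b => if b then phi (mate G e) else phi e end.
have [meG _ mme] := mateE he.
have : colouring (pole23 G e w s) psi.
  split.
  - by move=> [x|[]]; rewrite inE //= => h; apply: phi0.
  - move=> [x|[]] //=; rewrite inE => xG.
    case: eqP => [->//|/eqP xe]; case: eqP => [->//|/eqP xme] /=; exact: phim.
  - move=> v /[!inE] /andP[vw vG].
    by rewrite sum_ends_at_pole //; apply: phis => //; rewrite inE.
move=> /hp; rewrite pole_conns => /(_ [:: inr false; inr true]).
by rewrite inE eqxx => /(_ isT); rewrite /flow !big_cons big_nil addr0.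
Qed.

Lemma pole_perfect (x1 x2 : colour) (y : D -> colour) :
    perfect (pole23 G e w s) -> x1 != 0 -> x2 != 0 ->
    {in ends_at G w, forall x, y x != 0} -> x1 + x2 != 0 ->
    x1 + x2 + \sum_(x in ends_at G w) y x = 0 ->
  exists phi, [/\ pole_colouring set0 phi, phi e = x1, phi (mate G e) = x2
                & {in ends_at G w, phi =1 y}].
Proof.
move=> hp hx1 hx2 y0 x12.
have sE : map inl s = nth [::] (conns (pole23 G e w s)) 1 by rewrite pole_conns.
move: pole_conns size_s (fun z (h : z \in s) => y0 z (etrans (esym (mem_s z)) h)).
rewrite -sum_s => cE.
case sq: s => [|a [|b [|c []]]] // _ {}y0; rewrite !big_cons big_nil addr0 !addrA => hsum.
have [||psi [psi0 psim psis]] := hp x1 x2 (y a) (y b) (y c) _ x12 _ hsum.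
- by split=> //; apply: y0; rewrite !inE eqxx ?orbT.
(* The three colours at [w] sum to [x1 + x2], so their flow is nonzero as well. *)
- move: x12; apply: contra => /eqP hy.
  by rewrite -[X in _ == X]hsum -!addrA (addrA (y a)) hy addr0.
rewrite cE sq /= => -[e1 e2 ea eb ec].
have [meG _ mme] := mateE he.
have psi_e : psi (inl e) = x1.
  by have := psim (inl e); rewrite inE /= eqxx => /(_ he) <-.
have psi_me : psi (inl (mate G e)) = x2.
  have := psim (inl (mate G e)); rewrite inE /= eqxx; case: eqP => [h|_].
    by have [_] := mateE he; rewrite h eqxx.
  by move=> /(_ meG) <-.
exists (psi \o inl); split=> //; last first.
  by move=> x; rewrite -mem_s sq !inE => /or3P[] /eqP-> /=.
split=> [x xG|x xG xe xme|v vG vw _] /=.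
- by apply: psi0; rewrite inE.
- by have := psim (inl x); rewrite inE /= (negPf xe) (negPf xme); apply.
- by have := psis v; rewrite !inE vw vG sum_ends_at_pole //; apply.
Qed.

Lemma critical_colouring_off (u v : V) : critical G ->
  u \in vset G -> v \in vset G -> u != v -> adjacent G u v ->
  exists phi, colouring_off G [set u; v] phi.
Proof.
by move=> hc uG vG uv auv; apply: edge_colourable_colouring_off => //; apply: hc.
Qed.

Lemma colouring_off_pole (U U' : {set V}) phi :
  colouring_off G U phi -> {subset U <= w |: U'} ->
  pole_colouring U' phi.
Proof.
move=> [phi0 phim phis] UU'; split=> // [x xG _ _|v vG vw vU]; first exact: phim.
by apply: phis => //; apply: contra vU => /UU'; rewrite !inE (negPf vw).
Qed.

(** Steps that avoid both the edge [e] and the vertex [w] are the ones that survive in the composed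
    graph. *)
Definition pole_adjacent : rel V := [rel u v | [exists x in ends G,
  [&& x != e, x != mate G e, u != w, v != w, inc G x == Some u
    & inc G (mate G x) == Some v]]].

(* A part of the pole that misses both ends of [e] would give a nontrivial
   linear relation among the three colours at [w], contradicting perfection. *)
Lemma pole_reach v : perfect (pole23 G e w s) -> v \in vset G -> v != w ->
  exists x u, [/\ x = e \/ x = mate G e, inc G x = Some u & connect pole_adjacent v u].
Proof.
move=> hp vG vw.
pose inS x := if inc G x is Some a then connect pole_adjacent v a else false.
have [meG nme mme] := mateE he.
have [ue iue _] := incP he; have [um ium _] := incP meG.
have [/orP hS|nS] := boolP (inS e || inS (mate G e)).
  case: hS; rewrite /inS ?iue ?ium => hS.
    by exists e, ue; split=> //; left.
  by exists (mate G e), um; split=> //; right.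
move: nS; rewrite negb_or => /andP[/negPf nSe /negPf nSm].
have Sw a : connect pole_adjacent v a -> a != w.
  case/connectP=> p; case/lastP: p => [_ ->//|p z].
  rewrite rcons_path last_rcons => /andP[_ /existsP[x]] /and5P[_ _ _ _ /and3P[zw _ _]] ->.
  exact: zw.
(* If no end at [w] led into the component of [v], that component would be closed under adjacency in
   [G], and connectedness would put [w] into it. *)
have [z0 z0w Sz0] : exists2 z, z \in ends_at G w & inS (mate G z).
  have [_ _ _ [_ hcon] _] := hG.
  apply/exists_inP; apply: contraT => nex.
  have cl : closed (adjacent G) (connect pole_adjacent v).
    apply: intro_closed; first exact/sym_connect_sym/closed_adjacent_sym.
    move=> a b /existsP[x /and3P[xG /eqP ix /eqP imx]] va.
    have Sx : inS x by rewrite /inS ix.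
    have [mxG _ mmx] := mateE xG.
    have bw : b != w.
      apply: contra nex => /eqP bw; apply/exists_inP; exists (mate G x); last by rewrite mmx.
      by rewrite inE mxG imx bw eqxx.
    apply: (connect_trans va); apply: connect1; apply/existsP; exists x.
    rewrite xG ix imx !eqxx bw (Sw _ va) !andbT /=.
    by apply/andP; split; apply: contraTneq Sx => ->; rewrite ?nSe ?nSm.
  have /Sw : w \in connect pole_adjacent v.
    by rewrite -(closed_connect cl (hcon v w vG hw)); apply: connect0.
  by rewrite eqxx.
(* With [b] on [z0] and [a] on the other two ends at [w], no set of these ends that contains [z0]
   has sum 0: the possible sums are [b] and [a + b]. *)
pose a : colour := (1, 0); pose b : colour := (0, 1).
pose y z := if z == z0 then b else a.
have card_w := card_ends hw.
have /card_gt0P[z1 /setD1P[z10 z1w]] : (0 < #|ends_at G w :\ z0|)%N.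
  by have := cardsD1 z0 (ends_at G w); rewrite z0w card_w add1n => -[<-].
have z01 : z0 != z1 by rewrite eq_sym.
have [z2 [z2w z20 z21 wE]] := card3_set card_w z0w z1w z01.
have [|||||phi [[phi0 phim phis] _ _ phiy]] := @pole_perfect a (a + b) y hp.
- by [].
- by [].
- by move=> x _; rewrite /y; case: ifP.
- by [].
- rewrite wE sum_set3 // /y eqxx (negPf z10) (negPf z20).
  exact/eqP.
(* Neither end of [e] lies in the component, so [psi] agrees across every edge, including [e]. By
   parity the ends at [w] that lead into the component have sum 0. *)
pose psi x := if inS x || inS (mate G x) then phi x else 0.
have psim : {in ends G, forall x, psi (mate G x) = psi x}.
  move=> x xG; have [mxG _ mmx] := mateE xG; rewrite /psi mmx orbC.
  case: ifP => // Sx; apply: phim => //; apply: contraTneq Sx => ->.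
    by rewrite nSe nSm.
  by rewrite mme nSe nSm.
have := closed_parity cG psim; rewrite (bigD1 w) //= [X in _ + X]big1 ?addr0; last first.
  move=> u /andP[uG uw]; have [Su|nSu] := boolP (connect pole_adjacent v u).
    rewrite -[RHS](phis u) ?inE //; apply: eq_bigr => x /[!inE] /andP[_ /eqP ix].
    by rewrite /psi /inS ix Su.
  apply: big1 => x /[!inE] /andP[xG /eqP ix]; rewrite /psi {1}/inS ix (negPf nSu) /=.
  case: ifP => // Smx; case/negP: nSu; have [mxG _ mmx] := mateE xG.
  move: (Smx); rewrite {1}/inS; case imx: (inc G (mate G x)) => [c|//] vc.
  apply: (connect_trans vc); apply: connect1; apply/existsP; exists (mate G x).
  rewrite mxG mmx ix imx !eqxx uw (Sw _ vc) !andbT /=.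
  by apply/andP; split; apply: contraTneq Smx => ->; rewrite ?nSe ?nSm.
have psiE z : z \in ends_at G w -> psi z = if inS (mate G z) then y z else 0.
  move=> zw; rewrite /psi phiy //; move: zw; rewrite inE => /andP[_ /eqP iz].
  have /negPf nSw : ~~ connect pole_adjacent v w by apply/negP=> /Sw; rewrite eqxx.
  by rewrite {1}/inS iz nSw.
rewrite wE sum_set3 // !psiE // Sz0 /y eqxx (negPf z10) (negPf z20).
by do 2!case: (inS _); move/eqP.
Qed.

End Pole.

(** * Colourings of a pole obtained from an essential pair *)

Section Good.
Local Open Scope ring_scope.
Variables (V D : finType) (G : multipole V D) (w : V).
Hypotheses (hG : snark G) (hw : w \in vset G).

Let cG := snark_closed_cubic hG.
Let mateE := mateE hG.
Let mate_inj : {in ends G &, injective (mate G)}.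
Proof. by apply: (can_in_inj (g := mate G)) => x /mateE[]. Qed.
Let incP := incP hG.
Let card_ends := card_ends hG.

(* Smoothing at [t] forces equal colours on the two edges at [t] other than
   [x]; the colour of [g] is read off at its end away from [w], so that the
   parity argument gives the flow out of [w]. *)
Lemma essential_colouring x g t : essential G x g -> x \in ends G ->
    inc G x = Some t -> inc G (mate G x) <> Some w -> t != w ->
    g \in ends_at G w -> inc G (mate G g) != Some t ->
  exists delta, forall c, c != 0 -> exists phi,
    [/\ pole_colouring G x w [set t] phi, phi x = c, phi (mate G x) = delta
      & \sum_(z in ends_at G w) phi z = delta].
Proof.
case=> [[_ _ gx gmx] _]; set N := sub_edge _ _ => hN xG ix imx tw gw imgt.
have [gG ig] : g \in ends G /\ inc G g = Some w.
  by move: gw; rewrite inE => /andP[? /eqP].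
have [mxG nmx mmx] := mateE xG; have [mgG nmg mmg] := mateE gG.
have loop z : z \in ends G -> inc G (mate G z) != inc G z by exact: snark_loopless.
have tG : t \in vset G by have [_ vM _ _] := cG; apply: vM ix.
(* The ends of [G] inside the twice cut multipole; its four remaining ends are the new semiedges. *)
pose ii z : D + bool + bool := inl (inl z).
have eq_ii z z' : (ii z == ii z') = (z == z') by [].
have endsN z : (ii z \in ends N) = (z \in ends G) by rewrite inE /= inE.
have incN z : inc N (ii z) = inc G z by [].
have mNE z : mate N (ii z) =
    if z == g then inr false else if z == mate G g then inr true
    else inl (if z == x then inr false else if z == mate G x then inr true
              else inl (mate G z)).
  by rewrite /N /ii /= (negPf gx) (negPf gmx).
have mNii z : z != g -> z != mate G g -> z != x -> z != mate G x ->
    mate N (ii z) = ii (mate G z).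
  by move=> *; rewrite mNE !ifN.
have xg : x != g by rewrite eq_sym.
have xmg : x != mate G g by rewrite -eq_mate // eq_sym.
have dE : dangling_at N t = [set ii x].
  apply/setP=> -[[z|b]|b]; rewrite [LHS]inE [X in X && _]inE [RHS]inE; last 2 first.
  - by rewrite andbF.
  - by rewrite andbF.
  rewrite -/(ii z) endsN incN eq_ii.
  have [->|zx] := eqVneq z x.
    by rewrite xG ix eqxx mNE (negPf xg) (negPf xmg) eqxx.
  apply/negP=> /andP[/andP[zG /eqP iz]].
  rewrite mNii //; first by have [mzG _ _] := mateE zG; rewrite incN; have [? ->] := incP mzG.
  - by apply: contraNneq tw => zg; move: iz; rewrite zg ig => -[->].
  - by apply: contraNneq imgt => <-; rewrite iz.
  - by apply: contraTneq (loop x xG) => <-; rewrite iz ix eqxx.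
have [|psi [psi0 psim psis]] := hN t tG; first by rewrite dE cards1.
have endsS z : (ii z \in ends (smooth N t)) = (z \in ends G) && (inc G z != Some t).
  rewrite inE dE endsN incN inE mNE.
  have [zG|//] := boolP (z \in ends G); case: (_ != Some t) => //=.
  case: (z == g) => //; case: (z == mate G g) => //; case: (z =P x) => // zx.
  case: (z =P mate G x) => // zmx; rewrite -/(ii _) eq_ii.
  by apply/eqP=> mzx; case: zmx; have [_ _ <-] := mateE zG; rewrite mzx.
have ends_t : ends_at N t :\: dangling_at N t = [set ii z | z in ends_at G t :\ x].
  rewrite dE; apply/setP=> -[[z|b]|b]; rewrite inE [X in _ && X]inE; last 2 first.
  - by rewrite !andbF; apply/esym/imsetP=> -[].
  - by rewrite !andbF; apply/esym/imsetP=> -[].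
  by rewrite inE -/(ii z) endsN incN eq_ii mem_imset ?in_setD1 ?inE // => ? ? [].
have xt : x \in ends_at G t by rewrite inE xG ix eqxx.
have [a [b [ab at_ bt tE]]] : exists a b, [/\ a != b, a \in ends_at G t,
    b \in ends_at G t & ends_at G t :\ x = [set a; b]].
  have : #|ends_at G t :\ x| = 2%N.
    by have := cardsD1 x (ends_at G t); rewrite xt card_ends // add1n => -[<-].
  move/eqP/cards2P=> [a [b [ab E]]]; exists a, b; split=> //.
    by have /setD1P[] : a \in ends_at G t :\ x by rewrite E !inE eqxx.
  by have /setD1P[] : b \in ends_at G t :\ x by rewrite E !inE eqxx orbT.
have ordinary z : z \in ends_at G t :\ x ->
   [/\ z \in ends G, inc G z = Some t, z != x & mate N (ii z) = ii (mate G z)].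
  case/setD1P=> zx; rewrite inE => /andP[zG /eqP iz]; split=> //.
  apply: mNii => //.
  - by apply: contraNneq tw => zg; move: iz; rewrite zg ig => -[->].
  - by apply: contraNneq imgt => <-; rewrite iz.
  - by apply: contraTneq (loop x xG) => <-; rewrite iz ix eqxx.
have mS z : mate (smooth N t) z = if inc N (mate N z) == Some t then
    if [pick z' in ends_at N t :\: dangling_at N t | z' != mate N z] is Some z'
    then mate N z' else mate N z else mate N z by [].
have psiM z : z \in ends G -> inc G z != Some t -> inc G (mate G z) != Some t ->
   z != g -> z != mate G g -> z != mate G x -> psi (ii (mate G z)) = psi (ii z).
  move=> zG iz imz zg zmg zmx.
  have zx : z != x by apply: contraNneq iz => ->; rewrite ix.
  have := psim (ii z); rewrite endsS zG iz => /(_ isT) <-.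
  by rewrite mS mNii // incN (negPf imz).
have psi_nz z : z \in ends G -> inc G z != Some t -> psi (ii z) != 0.
  by move=> zG iz; apply: psi0; rewrite endsS zG.
(* Smoothing at [t] makes the far ends of the edges through [a] and [b] the two ends of one edge. *)
have psi_ab : psi (ii (mate G a)) = psi (ii (mate G b)).
  have [|aG ia ax maE] := ordinary a; first by rewrite tE !inE eqxx.
  have [|bG ib bx mbE] := ordinary b; first by rewrite tE !inE eqxx orbT.
  have [maG _ mma] := mateE aG; have la := loop a aG; rewrite ia in la.
  have := psim (ii (mate G a)); rewrite endsS maG la => /(_ isT) <-.
  rewrite mS mNii //; first last.
  - by rewrite (inj_in_eq mate_inj).
  - by rewrite eq_mate //; apply: contraTneq (loop x xG) => <-; rewrite ia ix eqxx.
  - rewrite (inj_in_eq mate_inj) //; apply: contraNneq tw => ag.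
    by move: ia; rewrite ag ig => -[->].
  - by rewrite eq_mate //; apply: contraNneq imgt => <-; rewrite ia.
  rewrite mma incN ia eqxx ends_t tE; case: pickP => [z /andP[]|/(_ (ii b))].
    by case/imsetP=> z' /set2P[]-> ->; rewrite ?eqxx // => _; rewrite mbE.
  by rewrite imset_f ?eq_ii 1?eq_sym ?ab // !inE eqxx orbT.
(* The end [x] lies at the defect [t], and its edge is cut, so any colour [c] is allowed on it
   without affecting the colour of the other half. *)
exists (psi (ii (mate G x))) => c c0.
(* The ends at [t] have disappeared in the smoothing, and the edge of [g] has been cut; each of
   these ends copies the colour of its mate. *)
pose phi z := if z == x then c else if (z == g) || (inc G z == Some t)
  then psi (ii (mate G z)) else psi (ii z).
have phi_t z : z \in ends_at G t :\ x -> phi z = psi (ii (mate G z)).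
  by case/ordinary=> _ iz /negPf zx _; rewrite /phi zx iz eqxx orbT.
have phi_mx : phi (mate G x) = psi (ii (mate G x)).
  rewrite /phi (negPf nmx) eq_mate // (negPf xmg) -ix (negPf (loop x xG)).
  by [].
have phi_other z : z \in ends G -> inc G z != Some t -> z != g -> phi z = psi (ii z).
  move=> zG iz zg; rewrite /phi (negPf zg) (negPf iz); case: eqP => // zx.
  by rewrite zx ix eqxx in iz.
have sum_other v : v \in vset G -> v != w -> v != t -> \sum_(z in ends_at G v) phi z = 0.
  move=> vG vw vt; rewrite -[RHS](psis v) ?inE ?vt //.
  have -> : ends_at (smooth N t) v = [set ii z | z in ends_at G v].
    apply/setP=> -[[z|b']|b']; rewrite [LHS]inE; last 2 first.
    - by rewrite andbF; apply/esym/imsetP=> -[].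
    - by rewrite andbF; apply/esym/imsetP=> -[].
    rewrite -/(ii z) endsS mem_imset ?inE; last by move=> ? ? [].
    rewrite incN -andbA; congr (_ && _).
    by case: eqP => //= iz; apply/esym/negbTE/eqP=> iz'; case/eqP: vt; move: iz; rewrite iz' => -[].
  rewrite big_imset /=; last by move=> ? ? _ _ [].
  apply: eq_bigr => z; rewrite inE => /andP[zG /eqP iz]; apply: phi_other => //.
    by rewrite iz; apply: contra vt => /eqP[->].
  by apply: contraNneq vw => zg; move: iz; rewrite zg ig => -[->].
have phi_nz : {in ends G, forall z, phi z != 0}.
  move=> z zG; rewrite /phi; case: (z =P x) => // _; have [mzG _ _] := mateE zG.
  case: ifPn => [/orP[/eqP zg|/eqP iz]|].
  - by apply: psi_nz => //; rewrite zg.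
  - by apply: psi_nz => //; rewrite -iz; apply: loop.
  - by rewrite negb_or => /andP[_ iz]; apply: psi_nz.
have phi_mate z : z \in ends G -> z != x -> z != mate G x -> phi (mate G z) = phi z.
  move=> zG zx zmx; have [mzG nmz mmz] := mateE zG.
  have phi_g : phi g = psi (ii (mate G g)) by rewrite /phi (negPf gx) eqxx.
  have [iz|iz] := eqVneq (inc G z) (Some t).
    rewrite [RHS]phi_t ?in_setD1 ?zx ?inE ?zG ?iz ?eqxx //.
    apply: phi_other => //; first by rewrite -iz; apply: loop.
    by rewrite eq_mate //; apply: contraNneq imgt => <-; rewrite iz.
  have [zg|zg] := eqVneq z g; first by rewrite zg phi_g phi_other.
  rewrite [RHS]phi_other //.
  have [mzg|mzg] := eqVneq (mate G z) g; first by rewrite mzg phi_g -mzg mmz.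
  have [imz|imz] := eqVneq (inc G (mate G z)) (Some t).
    by rewrite phi_t ?mmz // in_setD1 eq_mate // zmx inE mzG imz eqxx.
  by rewrite phi_other // psiM // -eq_mate.
exists phi; split.
- split; [exact: phi_nz|exact: phi_mate|].
  by move=> v vG vw; rewrite inE; apply: sum_other.
- by rewrite /phi eqxx.
- exact: phi_mx.
(* Undoing the cut at [x] makes parity applicable in [G]. The other two ends at [t] have equal
   colours and cancel, so the sum at [t] is [delta], and therefore so is the sum at [w]. *)
pose phi1 z := if z == x then phi (mate G x) else phi z.
have phi1m : {in ends G, forall z, phi1 (mate G z) = phi1 z}.
  move=> z zG; rewrite /phi1 eq_mate //.
  have [->|zmx] := eqVneq z (mate G x); first by rewrite (negPf nmx).
  by have [->|zx] := eqVneq z x => //; apply: phi_mate.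
have sum1 v : v != t -> \sum_(z in ends_at G v) phi1 z = \sum_(z in ends_at G v) phi z.
  move=> vt; apply: eq_bigr => z; rewrite inE /phi1 => /andP[_ /eqP iz].
  by case: eqP => // zx; case/eqP: vt; move: iz; rewrite zx ix => -[].
have := closed_parity cG phi1m; rewrite (bigD1 w) //= (bigD1 t) //= ?tG //.
rewrite [X in _ + (_ + X)]big1 ?addr0; last first.
  by move=> v /andP[/andP[vG vw] vt]; rewrite sum1 // sum_other.
rewrite sum1 1?eq_sym // [X in _ + X](big_setD1 x) //= {1}/phi1 eqxx tE.
rewrite big_setU1 ?inE //= big_set1.
have phi1_t z : z \in ends_at G t :\ x -> phi1 z = psi (ii (mate G z)).
  by move=> zt; rewrite -phi_t //; case/ordinary: zt => _ _ zx _; rewrite /phi1 (negPf zx).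
rewrite !phi1_t ?tE ?inE ?eqxx ?orbT // psi_ab addcc addr0.
by move/eqP; rewrite addc_eq0 phi_mx => /eqP.
Qed.

Lemma good_colouring x t : (forall f g, f \in ends G -> g \in ends G ->
      inc G f = Some t -> inc G g = Some w -> g != f -> g != mate G f ->
      essential G f g) ->
    x \in ends G -> inc G x = Some t -> inc G (mate G x) <> Some w -> t != w ->
  exists delta, forall c, c != 0 -> exists phi,
    [/\ pole_colouring G x w [set t] phi, phi x = c, phi (mate G x) = delta
      & \sum_(z in ends_at G w) phi z = delta].
Proof.
move=> hgood xG ix imx tw.
have tG : t \in vset G by have [_ vM _ _] := cG; apply: vM ix.
have xt : x \in ends_at G t by rewrite inE xG ix eqxx.
have [mxG _ _] := mateE xG.
(* Otherwise [mate] would inject the three ends at [w] into the two ends at [t] other than [x]. *)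
have [g gw imgt] : exists2 g, g \in ends_at G w & inc G (mate G g) != Some t.
  apply/exists_inP; apply: contraT => /exists_inPn h.
  have : mate G @: ends_at G w \subset ends_at G t :\ x.
    apply/subsetP=> _ /imsetP[g gw ->]; have := h _ gw; rewrite negbK => /eqP imgt.
    move: gw; rewrite inE => /andP[gG /eqP ig]; have [mgG _ _] := mateE gG.
    rewrite in_setD1 inE mgG imgt eqxx !andbT eq_mate //.
    by apply/eqP=> gmx; apply: imx; rewrite -gmx.
  move/subset_leq_card; have := cardsD1 x (ends_at G t).
  rewrite xt card_ends // add1n => -[<-]; rewrite card_in_imset ?card_ends //.
  by move=> y z /[!inE] /andP[yG _] /andP[zG _]; apply: mate_inj.
have /[!inE] /andP[gG /eqP ig] := gw.
apply: (essential_colouring (g := g)) => //; apply: hgood => //.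
  by apply: contraNneq tw => gx; move: ig; rewrite gx ix => -[->].
by apply/eqP=> gmx; apply: imx; rewrite -gmx.
Qed.

End Good.

(** * The composed graph *)

Section Junctions.
Variables (V D : finType).
Implicit Types (M : multipole V D) (ps : seq (D * D)).

Notation junctions := (foldl (@junction V D)).
Notation joined ps := (unzip1 ps ++ unzip2 ps).

Lemma vset_junctions M ps : vset (junctions M ps) = vset M.
Proof. by elim: ps M => //= p ps IH M; rewrite IH. Qed.

Lemma inc_junctions M ps : inc (junctions M ps) = inc M.
Proof. by elim: ps M => //= p ps IH M; rewrite IH. Qed.

Lemma ends_junctions M ps :
  ends (junctions M ps) = [set x in ends M | x \notin joined ps].
Proof.
elim: ps M => [|p ps IH] M /=; first by apply/setP=> x; rewrite inE andbT.
rewrite IH; apply/setP=> x; rewrite !(inE, mem_cat) !negb_or.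
by case: (x == p.1); case: (x == p.2); case: (x \in ends M); rewrite /= ?andbF.
Qed.

(** When no edge has two joined semiedges as its ends, successive junctions do not interact: each
    one only pairs the inner ends of its own two dangling edges. *)
Lemma mate_junctions M ps :
    uniq (joined ps) -> {in joined ps, forall x, mate M x \notin joined ps} ->
    {in joined ps &, injective (mate M)} ->
  (forall p, p \in ps -> mate (junctions M ps) (mate M p.1) = mate M p.2 /\
                         mate (junctions M ps) (mate M p.2) = mate M p.1) /\
  (forall x, x \notin map (mate M) (joined ps) -> mate (junctions M ps) x = mate M x).
Proof.
elim: ps M => [|p ps IH] M // hu hm hi.
have sub : {subset joined ps <= joined (p :: ps)}.
  by move=> x; rewrite /= inE !mem_cat inE => /orP[] ->; rewrite !orbT.
have p1 : p.1 \in joined (p :: ps) by rewrite /= mem_head.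
have p2 : p.2 \in joined (p :: ps) by rewrite /= inE mem_cat mem_head !orbT.
have : uniq [:: p.1, p.2 & joined ps].
  rewrite -(perm_uniq (s1 := joined (p :: ps))) //= perm_cons.
  exact/permEl/(perm_catCA (unzip1 ps) [:: p.2]).
rewrite [uniq _]/= inE negb_or => /and3P[/andP[np12 np1] np2 hu'].
have mpE : mate (junction M p) =1 [fun x => mate M x with mate M p.1 |-> mate M p.2,
                            mate M p.2 |-> mate M p.1] by [].
have mpN x : x \in joined (p :: ps) -> mate (junction M p) x = mate M x.
  move=> hx; rewrite mpE /=; case: eqP => [E|_]; first by rewrite E (negPf (hm _ p1)) in hx.
  by case: eqP => [E|_] //; rewrite E (negPf (hm _ p2)) in hx.
have notin x : x \in joined (p :: ps) -> x \notin joined ps ->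
    mate M x \notin map (mate (junction M p)) (joined ps).
  move=> hx hnx; apply/mapP=> -[z hz]; rewrite mpN ?sub // => /hi E.
  by move: hnx; rewrite E ?hz // sub.
have uj : uniq (joined ps) by [].
have [|||hp hx] := IH (junction M p).
- by [].
- by move=> x xj; rewrite mpN ?sub //; apply: contra (hm _ (sub _ xj)); apply: sub.
- by move=> x y xj yj; rewrite !mpN ?sub //; apply: hi; apply: sub.
split=> [q|x hxn].
  rewrite inE => /orP[/eqP->|qps]; last first.
    have q1 : q.1 \in joined ps by rewrite mem_cat map_f.
    have q2 : q.2 \in joined ps by rewrite mem_cat map_f ?orbT.
    by have := hp q qps; rewrite !mpN ?sub.
  rewrite /= !hx ?notin // !mpE /= !eqxx; split=> //; by case: eqP.
rewrite /= hx; last first.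
  apply: contra hxn => /mapP[z hz ->]; rewrite mpN ?sub //.
  by apply/map_f/sub.
rewrite mpE /= !ifN //; apply: contraNneq hxn => ->; exact: map_f.
Qed.

(** An invariant for showing that no connector survives: with [P] the set of joined semiedges, a
    remaining connector would contain a joined semiedge that is still an end. *)
Lemma conns_junctions (P : pred D) M ps :
    (forall q, q \in conns M -> q != [::] /\ {in q, forall x, P x /\ x \in ends M}) ->
  forall q, q \in conns (junctions M ps) ->
    q != [::] /\ {in q, forall x, P x /\ x \in ends (junctions M ps)}.
Proof.
elim: ps M => //= p ps IH M hM; apply: IH => q; rewrite mem_filter => /andP[qn].
case/mapP=> q0 q0M E; split=> // x; rewrite E mem_filter => /andP[xA xq].
by have [_ /(_ _ xq)[]] := hM _ q0M.
Qed.

End Junctions.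

(** * The array of colours between poles and new vertices *)

Section Rows.
Local Open Scope ring_scope.

Lemma ord3_cases (i j : 'I_3) : [\/ j = i, j = ordS i | j = ord_pred i].
Proof.
case: i j => [[|[|[|//]]] hi] [[|[|[|//]]] hj];
  by [apply: Or31; apply: val_inj|apply: Or32; apply: val_inj|apply: Or33; apply: val_inj].
Qed.

Lemma ord3_distinct (i : 'I_3) :
  [/\ ordS i != i, ord_pred i != i & ord_pred i != ordS i].
Proof. by case: i => [[|[|[|//]]] hi]. Qed.

Lemma sum_ord3 (i : 'I_3) (f : 'I_3 -> colour) :
  \sum_(j < 3) f j = f i + f (ordS i) + f (ord_pred i).
Proof.
have [si pi ps] := ord3_distinct i.
rewrite (bigD1 i) // (bigD1 (ordS i)) //= (bigD1 (ord_pred i)) ?pi //=.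
rewrite big1 ?addr0 ?addrA // => j /andP[/andP[ji js] jp].
by case: (ord3_cases i j) => jE; rewrite jE eqxx in ji js jp.
Qed.

(** The entry [Y i' k] is to colour the edge between pole [i'] and the new vertex [k], and [uc]
    marks the removed new vertices. One exempt column is enough for the search, so a single witness
    of [uc] is passed on. *)
Lemma complete_rows (i : 'I_3) (y F : 'I_3 -> colour) (uc : pred 'I_3) :
    (forall k, y k != 0) -> (forall i', i' != i -> F i' != 0) ->
    (exists k, uc k) \/ \sum_k y k + \sum_(i' | i' != i) F i' = 0 ->
  exists Y : 'I_3 -> 'I_3 -> colour, [/\ Y i =1 y, forall i' k, Y i' k != 0,
     forall i', i' != i -> \sum_k Y i' k = F i'
   & forall k, ~~ uc k -> \sum_i' Y i' k = 0].
Proof.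
move=> y0 F0 huc.
have [si pi ps] := ord3_distinct i.
pose i0 : 'I_3 := ord0; pose i1 := ordS i0; pose i2 := ord_pred i0.
have [k [k3 ksum kuc]] : exists k : nat, [/\ (k <= 3)%N,
   (k < 3)%N || (y i0 + y i1 + y i2 + F (ordS i) + F (ord_pred i) == 0)
   & forall j : 'I_3, ~~ uc j -> j != k :> nat].
  case: huc => [[k uck]|hsum].
    exists k; rewrite ltn_ord (ltnW (ltn_ord k)); split=> // j; apply: contra.
    by move/eqP/val_inj=> ->.
  exists 3; split=> // [|j _]; last by rewrite neq_ltn ltn_ord.
  rewrite -hsum (sum_ord3 i0) -!addrA; do 3 apply/eqP; congr (_ + (_ + (_ + _))).
  apply/esym; have := sum_ord3 i (fun j => if j != i then F j else 0).
  by rewrite -big_mkcond /= eqxx si pi add0r.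
have [z [t [hz ht zs ts hj]]] := complete_rows3 k3 (And3 (y0 i0) (y0 i1) (y0 i2))
  (F0 _ si) (F0 _ pi) ksum.
have sumk (f : nat -> colour) : \sum_(j < 3) f j = f 0%N + f 1%N + f 2%N.
  by rewrite !big_ord_recl big_ord0 addr0 addrA.
exists (fun i' j => if i' == i then y j else if i' == ordS i then emb (bnth z j)
  else emb (bnth t j)); split=> [j|i' j|i' i'i|j uj].
- by rewrite eqxx.
- case: ifP => // _; case: ifP => _; exact/bcolours_neq0/triplesP.
- rewrite (negPf i'i); case: (ord3_cases i i') => i'E; rewrite ?i'E ?eqxx ?(negPf ps) in i'i *.
  + by [].
  + by rewrite (sumk (fun j => emb (bnth z j))).
  + by rewrite (sumk (fun j => emb (bnth t j))).
- rewrite (sum_ord3 i) !eqxx (negPf si) (negPf pi) (negPf ps).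
  rewrite -[RHS](hj j) ?kuc //; congr (_ + _ + _).
  by case: (ord3_cases i0 j) => ->.
Qed.

End Rows.

(** * Ends, mates and vertices of the composed graph *)

Section Graph.
Local Open Scope ring_scope.
Variables (V D : 'I_3 -> finType) (G : forall i, multipole (V i) (D i)).
Variables (e : forall i, D i) (w : forall i, V i) (s : forall i, seq (D i)).
Hypotheses (hG : forall i, snark (G i)) (he : forall i, e i \in ends (G i)).
Hypothesis hw : forall i, w i \in vset (G i).
Hypothesis hew : forall i, inc (G i) (e i) <> Some (w i) /\
                     inc (G i) (mate (G i) (e i)) <> Some (w i).
Hypothesis hs : forall i, perm_eq (s i) (enum (ends_at (G i) (w i))).

Notation T := (fun i => pole23 (G i) (e i) (w i) (s i)).
Notation Gam := (compose H6 (TTTsc T)).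
Notation VG := ('I_6 + ({i & V i} + 'I_3))%type.
Notation DG := (('I_6 * (bool * bool)) + {i & (D i + bool)%type})%type.

Definition hex_end (j : 'I_6) (c b : bool) : DG := inl (j, (c, b)).
Definition pole_end (i : 'I_3) (x : D i) : DG :=
  inr (@Tagged _ i (fun i => (D i + bool)%type) (inl x)).
Definition cut_end (i : 'I_3) (b : bool) : DG :=
  inr (@Tagged _ i (fun i => (D i + bool)%type) (inr b)).
Definition hex_vertex (j : 'I_6) : VG := inl j.
Definition pole_vertex (i : 'I_3) (v : V i) : VG := inr (inl (Tagged V v)).
Definition new_vertex (k : 'I_3) : VG := inr (inr k).

Let joints : seq (DG * DG) := zip (map inl (flatten (conns H6))) (map inr (flatten (conns (TTTsc T)))).

Let jointsE : joints =
  [seq (hex_end (pole_index i b) false true, cut_end i b)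
     | i <- enum 'I_3, b <- [:: false; true]].
Proof.
rewrite /joints.
have -> : conns H6 = [seq [seq (pole_index i b, (false, true)) | b <- [:: false; true]]
    | i <- enum 'I_3].
  rewrite -[LHS]/([seq [:: (inord k : 'I_6, (false, true));
    (inord (k + 3)%N, (false, true))] | k <- iota 0 3]).
  rewrite -val_enum_ord -map_comp; apply: eq_map => i /=.
  by rewrite /pole_index muln0 addn0 muln1.
rewrite /joints /=; have -> : [seq [seq Tagged (fun i => (D i + bool)%type) x
      | x <- nth [::] (conns (T i)) 0] | i <- enum 'I_3] =
   [seq [seq @Tagged _ i (fun i => (D i + bool)%type) (inr b) | b <- [:: false; true]] | i <- enum 'I_3].
  by apply: eq_map => i; rewrite pole_conns.
by case: (enum 'I_3) (size_enum_ord 3) => [|i0 [|i1 [|i2 []]]].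
Qed.

Lemma pole_index_surj j : exists i b, j = pole_index i b.
Proof.
pose i : 'I_3 := inord (j %% 3); exists i, (2 < j)%N; apply: val_inj.
rewrite /= val_pole_index /i inordK ?ltn_mod //.
by case: j {i} => [[|[|[|[|[|[|//]]]]]] ?].
Qed.

Lemma pole_index_inj i i' b b' :
  pole_index i b = pole_index i' b' -> i = i' /\ b = b'.
Proof.
move/(congr1 val) => /=; rewrite !val_pole_index => h; split; last first.
  by case: i i' b b' h => [[|[|[|//]]] ?] [[|[|[|//]]] ?] [|] [|].
apply: val_inj.
by case: i i' b b' h => [[|[|[|//]]] ?] [[|[|[|//]]] ?] [|] [|].
Qed.

Lemma pole_end_inj i : injective (@pole_end i).
Proof. by move=> x y [/eqP]; rewrite eq_Tagged => /eqP[]. Qed.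

Lemma cut_end_inj i i' b b' : cut_end i b = cut_end i' b' -> i = i' /\ b = b'.
Proof.
by case=> -> ->.
Qed.

Definition is_joint (x : DG) : bool :=
  match x with
  | inl (j, (c, b)) => ~~ c && b
  | inr z => if tagged z is inr _ then true else false
  end.

Let mem_joints x : (x \in unzip1 joints ++ unzip2 joints) = is_joint x.
Proof.
have m i b : (hex_end (pole_index i b) false true, cut_end i b) \in joints.
  by rewrite jointsE; apply: allpairs_f; rewrite ?mem_enum //; case: b.
rewrite mem_cat; apply/idP/idP.
  by rewrite jointsE => /orP[] /mapP[p /allpairsP[[i b] [_ _ ->]] ->].
case: x => [[j [[|] [|]]]|[i [x|b]]] //= _; apply/orP; last first.
  by right; apply/mapP; exists (hex_end (pole_index i b) false true, cut_end i b).
have [i [b ->]] := pole_index_surj j.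
by left; apply/mapP; exists (hex_end (pole_index i b) false true, cut_end i b).
Qed.

Let Gam_junctions : Gam = foldl (@junction _ _) (disjoint_union H6 (TTTsc T)) joints.
Proof. by []. Qed.

Let uniq_joints : uniq (unzip1 joints ++ unzip2 joints).
Proof.
rewrite cat_uniq; apply/and3P; split.
- rewrite /unzip1 jointsE map_allpairs allpairs_uniq ?enum_uniq //.
  by move=> [i b] [i' b'] _ _ [/pole_index_inj [/= -> ->]].
- by apply/hasP=> -[x] /mapP[p hp ->] /mapP[q]; rewrite jointsE in hp *;
    case/allpairsP: hp => -[i b] [_ _ ->] /allpairsP[[i' b'] [_ _ ->]].
- rewrite /unzip2 jointsE map_allpairs allpairs_uniq ?enum_uniq //.
  by move=> [i b] [i' b'] _ _ /= /cut_end_inj [-> ->].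
Qed.

Lemma vset_Gam : vset Gam = [set u | match u with
  | inr (inl a) => (tagged a \in vset (G (tag a))) && (tagged a != w (tag a))
  | _ => true end].
Proof.
rewrite Gam_junctions vset_junctions; apply/setP=> -[j|[a|k]]; rewrite !inE //=.
by rewrite ?inE andbC.
Qed.

Lemma ends_Gam : ends Gam = [set x | match x with
  | inl (j, (c, b)) => c || ~~ b
  | inr z => if tagged z is inl y then y \in ends (G (tag z)) else false end].
Proof.
rewrite Gam_junctions ends_junctions; apply/setP=> x; rewrite !inE mem_joints.
case: x => [[j [[|] [|]]]|[i [x|b]]] //=; rewrite !inE ?andbT ?andbF //=.
Qed.

Lemma inc_hex j c b : inc Gam (hex_end j c b) = if ~~ c && b then None else Some (hex_vertex j).
Proof. by rewrite Gam_junctions inc_junctions /=; case: ifP. Qed.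

Lemma inc_pole i x v : inc (G i) x = Some v -> v != w i ->
  inc Gam (pole_end x) = Some (pole_vertex v).
Proof.
move=> ix vw; rewrite Gam_junctions inc_junctions /= ix.
by case: eqP => // -[vw']; rewrite vw' eqxx in vw.
Qed.

Lemma inc_pole_w i x : x \in ends_at (G i) (w i) ->
  inc Gam (pole_end x) = Some (new_vertex (inord (index x (s i)))).
Proof.
move=> xw; have := xw; rewrite inE => /andP[xG /eqP ix].
rewrite Gam_junctions inc_junctions /= ix eqxx (snark_conns (hG i)) /=.
rewrite (mem_map inl_inj) (mem_s (hs i)) xw index_map //; exact: inl_inj.
Qed.

Let mate_joint x : is_joint x -> ~~ is_joint (mate (disjoint_union H6 (TTTsc T)) x).
Proof. by case: x => [[j [[|] [|]]]|[i [x|b]]]. Qed.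

Let mate_joint_inj : {in is_joint &, injective (mate (disjoint_union H6 (TTTsc T)))}.
Proof.
move=> [[j [[|] [|]]]|[i [x|b]]] [[j' [[|] [|]]]|[i' [x'|b']]] //= _ _ [].
  by move=> ->.
move=> ii'; case: i' / ii' b' => b' /eqP; rewrite eq_Tagged => /eqP[].
have [_ nm _] := mateE (hG i) (he i).
by case: b b' => [] [] // /eqP; rewrite ?(negPf nm) // eq_sym (negPf nm).
Qed.

Let mate_Gam := mate_junctions uniq_joints
  (fun x hx => etrans (congr1 negb (mem_joints _))
     (mate_joint (etrans (esym (mem_joints x)) hx)))
  (fun x y hx hy => mate_joint_inj (etrans (esym (mem_joints x)) hx)
     (etrans (esym (mem_joints y)) hy)).

Let mate_joints i b : mate Gam (hex_end (pole_index i b) false false) =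
  pole_end (if b then mate (G i) (e i) else e i) /\
  mate Gam (pole_end (if b then mate (G i) (e i) else e i)) =
  hex_end (pole_index i b) false false.
Proof.
have [+ _] := mate_Gam => /(_ (hex_end (pole_index i b) false true, cut_end i b)).
by apply; rewrite jointsE; apply: allpairs_f; rewrite ?mem_enum //; case: b.
Qed.

Let mate_other x : x \notin map (mate (disjoint_union H6 (TTTsc T)))
    (unzip1 joints ++ unzip2 joints) -> mate Gam x = mate (disjoint_union H6 (TTTsc T)) x.
Proof. by have [_] := mate_Gam; apply. Qed.

Lemma mate_hex j b : mate Gam (hex_end j true b) =
  hex_end (if b then ordS j else ord_pred j) true (~~ b).
Proof.
rewrite mate_other //; apply/mapP=> -[x]; rewrite mem_joints.
by case: x => [[j' [[|] [|]]]|[i [x|b']]].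
Qed.

Lemma mate_spoke i b : mate Gam (hex_end (pole_index i b) false false) =
  pole_end (if b then mate (G i) (e i) else e i).
Proof. by case: (mate_joints i b). Qed.

Lemma mate_cut i b : mate Gam (pole_end (if b then mate (G i) (e i) else e i)) =
  hex_end (pole_index i b) false false.
Proof. by case: (mate_joints i b). Qed.

Lemma mate_pole i x : x != e i -> x != mate (G i) (e i) ->
  mate Gam (pole_end x) = pole_end (mate (G i) x).
Proof.
move=> xe xm; rewrite mate_other /=.
  by rewrite (negPf xe) (negPf xm).
apply/mapP=> -[z]; rewrite mem_joints.
case: z => [[j' [[|] [|]]]|[i' [x'|b']]] //= _ [ii'].
case: i' / ii' b' => b' /eqP; rewrite eq_Tagged => /eqP[].
by case: b' => /= xE; [move: xm|move: xe]; rewrite xE eqxx.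
Qed.

Lemma mate_pole_e i : mate Gam (pole_end (e i)) = hex_end (pole_index i false) false false.
Proof. exact: (mate_cut i false). Qed.

Lemma mate_pole_me i :
  mate Gam (pole_end (mate (G i) (e i))) = hex_end (pole_index i true) false false.
Proof. exact: (mate_cut i true). Qed.

Lemma mem_hex_end j c b : (hex_end j c b \in ends Gam) = c || ~~ b.
Proof. by rewrite ends_Gam inE. Qed.

Lemma mem_pole_end i (x : D i) : (pole_end x \in ends Gam) = (x \in ends (G i)).
Proof. by rewrite ends_Gam inE. Qed.

Lemma ends_GamP (P : DG -> Prop) :
    (forall j b, P (hex_end j true b)) -> (forall j, P (hex_end j false false)) ->
    (forall i x, x \in ends (G i) -> P (pole_end x)) ->
  forall x, x \in ends Gam -> P x.
Proof.
move=> h1 h2 h3 [[j [[] b]]|[i [x|b]]]; rewrite ends_Gam inE //=.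
- by move=> _; apply: h1.
- by case: b => // _; apply: h2.
- by move=> xG; apply: h3.
Qed.

Lemma inc_poleP i x : x \in ends (G i) ->
  (x \in ends_at (G i) (w i) /\
   inc Gam (pole_end x) = Some (new_vertex (inord (index x (s i))))) \/
  (exists v, [/\ inc (G i) x = Some v, v \in vset (G i), v != w i
     & inc Gam (pole_end x) = Some (pole_vertex v)]).
Proof.
move=> xG; have [v ix vG] := incP (hG i) xG; have [vw|vw] := eqVneq v (w i).
  have xw : x \in ends_at (G i) (w i) by rewrite inE xG ix vw eqxx.
  by left; split=> //; apply: inc_pole_w.
by right; exists v; split=> //; apply: inc_pole.
Qed.

Lemma mem_vset_pole i v : (pole_vertex v \in vset Gam) = (v \in vset (G i)) && (v != w i).
Proof. by rewrite vset_Gam inE. Qed.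

Lemma ends_at_hex j : ends_at Gam (hex_vertex j) =
  [set hex_end j true true; hex_end j true false; hex_end j false false].
Proof.
apply/setP=> x; apply/idP/idP; last first.
  by rewrite !inE => /orP[/orP[]|] /eqP->; rewrite mem_hex_end inc_hex eqxx.
rewrite inE => /andP[]; move: x; apply: ends_GamP => [j' b|j'|i x xG].
- by rewrite inc_hex /= => /eqP[->]; case: b; rewrite !inE eqxx ?orbT.
- by rewrite inc_hex /= => /eqP[->]; rewrite !inE eqxx ?orbT.
- by case: (inc_poleP xG) => [[_ ->]|[v [_ _ _ ->]]].
Qed.

Lemma ends_at_pole_vertex i v : v != w i ->
  ends_at Gam (pole_vertex v) = [set pole_end x | x in ends_at (G i) v].
Proof.
move=> vw; apply/setP=> x; apply/idP/idP; last first.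
  case/imsetP=> y; rewrite inE => /andP[yG /eqP iy] ->.
  by rewrite inE mem_pole_end yG (inc_pole iy) ?eqxx.
rewrite inE => /andP[]; move: x; apply: ends_GamP => [j' b|j'|i' x xG].
- by rewrite inc_hex.
- by rewrite inc_hex.
case: (inc_poleP xG) => [[_ ->]//|[v' [ix _ _ ->]]] /eqP E.
have ii' : i' = i by case: E.
subst i'; case: E => /eqP; rewrite eq_Tagged => /eqP /= vv'.
by apply: imset_f; rewrite inE xG ix vv' eqxx.
Qed.

(** The end of pole [i] attached to the new vertex [k]. The default [e i] never occurs, as [s i] has
    size 3. *)
Definition cut_at (i k : 'I_3) : D i := nth (e i) (s i) k.

Lemma cut_at_mem i k : cut_at i k \in ends_at (G i) (w i).
Proof. by rewrite -(mem_s (hs i)) mem_nth // (size_s (hG i) (hw i)). Qed.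

Lemma inc_cut_at i k : inc Gam (pole_end (cut_at i k)) = Some (new_vertex k).
Proof.
rewrite inc_pole_w ?cut_at_mem // index_uniq ?(uniq_s (hs i)) ?inord_val //.
by rewrite (size_s (hG i) (hw i)).
Qed.

Lemma cut_atP i x : x \in ends_at (G i) (w i) -> exists k, x = cut_at i k.
Proof.
rewrite -(mem_s (hs i)) => xs; have hk := xs; rewrite -index_mem (size_s (hG i) (hw i) (hs i)) in hk.
by exists (Ordinal hk); rewrite /cut_at nth_index.
Qed.

Lemma ends_at_new k : ends_at Gam (new_vertex k) = [set pole_end (cut_at i k) | i : 'I_3].
Proof.
apply/setP=> x; apply/idP/idP; last first.
  case/imsetP=> i _ ->; rewrite inE mem_pole_end inc_cut_at eqxx andbT.
  by have := cut_at_mem i k; rewrite inE => /andP[].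
rewrite inE => /andP[]; move: x; apply: ends_GamP => [j' b|j'|i' x xG].
- by rewrite inc_hex.
- by rewrite inc_hex.
case: (inc_poleP xG) => [[/cut_atP[k' ->] _]|[v' [_ _ _ ->]] //].
by rewrite inc_cut_at => /eqP[->]; apply: imset_f.
Qed.

Lemma pole_end_cut_at_inj k : injective (fun i => pole_end (cut_at i k)).
Proof. by move=> i i' []. Qed.

Lemma sum_hex j (phi : DG -> colour) : \sum_(x in ends_at Gam (hex_vertex j)) phi x =
  phi (hex_end j true true) + phi (hex_end j true false) + phi (hex_end j false false).
Proof. by rewrite ends_at_hex sum_set3 //; apply/eqP=> -[]. Qed.

Lemma sum_pole i v (phi : DG -> colour) : v != w i ->
  \sum_(x in ends_at Gam (pole_vertex v)) phi x = \sum_(x in ends_at (G i) v) phi (pole_end x).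
Proof.
by move=> vw; rewrite ends_at_pole_vertex // big_imset // => x y _ _; apply: pole_end_inj.
Qed.

Lemma sum_new k (phi : DG -> colour) :
  \sum_(x in ends_at Gam (new_vertex k)) phi x = \sum_(i < 3) phi (pole_end (cut_at i k)).
Proof.
rewrite ends_at_new big_imset /=; last by move=> i i' _ _; apply: pole_end_cut_at_inj.
by [].
Qed.

Lemma closed_cubic_Gam : closed_cubic Gam.
Proof.
split.
- apply: ends_GamP => [j b|j|i x xG].
  + rewrite !mate_hex mem_hex_end; split=> //; first by case: b; apply/eqP=> -[].
    by case: b; rewrite /= ?ordSK ?ord_predK.
  + have [i [b ->]] := pole_index_surj j; rewrite mate_spoke mate_cut mem_pole_end.
    by split=> //; have [h _ _] := mateE (hG i) (he i); case: b.
  + have [mxG nmx mmx] := mateE (hG i) xG.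
    have [xe|xe] := eqVneq x (e i).
      by rewrite xe mate_pole_e (mate_spoke i false) mem_hex_end.
    have [xm|xm] := eqVneq x (mate (G i) (e i)).
      by rewrite xm mate_pole_me (mate_spoke i true) mem_hex_end.
    have [meG _ mme] := mateE (hG i) (he i).
    have mx1 : mate (G i) x != e i by rewrite (eq_mate (hG i)).
    have mx2 : mate (G i) x != mate (G i) (e i) by rewrite (eq_mate (hG i)) // mme.
    rewrite mate_pole // mem_pole_end mate_pole // mmx; split=> //.
    by apply: contra nmx => /eqP/pole_end_inj->.
- move=> x v xG; move: x xG v; apply: ends_GamP => [j b v|j v|i x xG u].
  + by rewrite inc_hex => -[<-]; rewrite vset_Gam inE.
  + by rewrite inc_hex => -[<-]; rewrite vset_Gam inE.
  + case: (inc_poleP xG) => [[_ ->]|[v [_ vG vw ->]]] [<-].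
      by rewrite vset_Gam inE.
    by rewrite mem_vset_pole vG.
- apply: ends_GamP => [j b|j|i x xG]; rewrite ?inc_hex //.
  by case: (inc_poleP xG) => [[_ ->]|[v [_ _ _ ->]]].
- move=> [j|[[i v]|k]] hv.
  + rewrite -/(hex_vertex j) ends_at_hex setUC cardsU1 cards2 !inE.
    by rewrite /hex_end !(inj_eq inl_inj) !xpair_eqE !andbF.
  + rewrite -/(pole_vertex v) in hv *; move: hv; rewrite mem_vset_pole => /andP[vG vw].
    by rewrite ends_at_pole_vertex // card_imset ?(card_ends (hG i)) //; apply: pole_end_inj.
  + rewrite -/(new_vertex k) ends_at_new card_imset ?card_ord //.
    exact: pole_end_cut_at_inj.
Qed.

Lemma conns_Gam : conns Gam = [::].
Proof.
have h : forall q, q \in conns Gam -> q != [::] /\ {in q, forall x, is_joint x /\ x \in ends Gam}.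
  apply: conns_junctions => q; rewrite mem_cat => /orP[] /mapP[q0].
    case/mapP=> k _ -> ->; split=> // x; rewrite !inE => /orP[]/eqP->; by rewrite ?inE.
  case/mapP=> i _ -> ->; rewrite pole_conns //=; split=> // x.
  by rewrite !inE => /orP[]/eqP->; rewrite ?inE.
case: (conns Gam) h => [//|[|x q] qs] h; first by have [] := h _ (mem_head _ _).
have [_ /(_ x (mem_head _ _))[xj]] := h _ (mem_head _ _).
by rewrite ends_Gam inE; case: x xj {h} => [[j [[] []]]|[i []]].
Qed.

(** * Gluing colourings of the poles and the hexagon *)

Hypothesis hproper : forall i, proper_pole (pole23 (G i) (e i) (w i) (s i)).
Hypothesis hperfect : forall i, perfect (pole23 (G i) (e i) (w i) (s i)).

Lemma sum_cut i (y : D i -> colour) :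
  \sum_(x in ends_at (G i) (w i)) y x = \sum_(k < 3) y (cut_at i k).
Proof.
rewrite -(sum_s (hs i)) (big_nth (e i)) (size_s (hG i) (hw i) (hs i)).
by rewrite big_mkord.
Qed.

Lemma pole_completion i (x1 x2 : colour) (y : 'I_3 -> colour) :
    x1 != 0 -> x2 != 0 -> (forall k, y k != 0) -> x1 + x2 != 0 ->
    \sum_k y k = x1 + x2 ->
  exists phi, [/\ pole_colouring (G i) (e i) (w i) set0 phi, phi (e i) = x1,
    phi (mate (G i) (e i)) = x2 & forall k, phi (cut_at i k) = y k].
Proof.
move=> hx1 hx2 y0 x12 ysum.
pose y' x := y (inord (index x (s i))).
have y'E k : y' (cut_at i k) = y k.
  by rewrite /y' index_uniq ?inord_val ?(uniq_s (hs i)) // (size_s (hG i) (hw i) (hs i)).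
have [|||phi [h1 h2 h3 h4]] := pole_perfect (hG i) (he i) (hw i) (hs i) 
    (hperfect i) hx1 hx2 (y := y').
- by move=> x _; apply: y0.
- by [].
- rewrite sum_cut; under eq_bigr do rewrite y'E; by rewrite ysum addcc.
exists phi; split=> // k; rewrite h4 ?y'E //.
exact: cut_at_mem.
Qed.

(** The common last step of all cases of criticality. Only pole [i] and the hexagon come with
    colours; the array fixes the ends of the other two poles, and perfection fills these in. The
    last hypothesis is the alternative required by [complete_rows]. *)
Lemma assemble (U : {set VG}) i (phi : D i -> colour) (h d : 'I_6 -> colour) :
    let F i' := d (pole_index i' false) + d (pole_index i' true) in
    pole_colouring (G i) (e i) (w i) [set v | pole_vertex v \in U] phi ->
    phi (e i) = d (pole_index i false) ->
    phi (mate (G i) (e i)) = d (pole_index i true) ->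
    (forall j, h j != 0) -> (forall j, d j != 0) ->
    (forall j, hex_vertex j \notin U -> h j + h (ord_pred j) + d j = 0) ->
    (forall i', i' != i -> F i' != 0) ->
    (exists k, new_vertex k \in U) \/
      \sum_(x in ends_at (G i) (w i)) phi x + \sum_(i' | i' != i) F i' = 0 ->
  exists Phi, colouring_off Gam U Phi.
Proof.
move=> F hphi phi_e phi_me h0 d0 hd F0 hU.
have [Y [Yi Y0 YF Yc]] : exists Y : 'I_3 -> 'I_3 -> colour,
   [/\ Y i =1 (fun k => phi (cut_at i k)), forall i' k, Y i' k != 0,
     forall i', i' != i -> \sum_k Y i' k = F i'
   & forall k, ~~ (new_vertex k \in U) -> \sum_i' Y i' k = 0].
  apply: complete_rows => //.
    move=> k; have [phi0 _ _] := hphi; apply: phi0.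
    by have := cut_at_mem i k; rewrite inE => /andP[].
  by rewrite -sum_cut.
have ex i' : exists psi : D i' -> colour, [/\ pole_colouring (G i') (e i') (w i')
     [set v | pole_vertex v \in U] psi, psi (e i') = d (pole_index i' false),
     psi (mate (G i') (e i')) = d (pole_index i' true)
     & forall k, psi (cut_at i' k) = Y i' k].
  have [ii'|i'i] := eqVneq i i'; first by case: i' / ii'; exists phi; split.
  rewrite eq_sym in i'i.
  have [|||psi [[p1 p2 p3] h2 h3 h4]] := @pole_completion i' _ _ (Y i') (d0 (pole_index i' false))
    (d0 (pole_index i' true)).
  - exact: Y0.
  - exact: F0.
  - exact: YF.
  exists psi; split=> //; split=> // v vG vw _; apply: p3 => //.
  by rewrite inE.
have [psi hpsi] := fin_all_exists ex.
(* The end of vertex [j] towards its predecessor belongs to the edge starting at [ord_pred j], hence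
   the shift of the index of [h]. *)
pose Phi (x : DG) : colour := match x with
  | inl (j, (c, b)) => if c then h (if b then j else ord_pred j) else d j
  | inr z => if tagged z is inl y then psi (tag z) y else 0 end.
exists Phi; split.
- apply: ends_GamP => [j b|j|i' x xG] //=.
  by have [[p0 _ _] _ _ _] := hpsi i'; apply: p0.
- apply: ends_GamP => [j b|j|i' x xG].
  + by rewrite mate_hex //; case: b => //=; rewrite ordSK.
  + have [i' [b ->]] := pole_index_surj j; rewrite mate_spoke //.
    by have [_ h1 h2 _] := hpsi i'; case: b.
  + have [[p0 pm _] h1 h2 _] := hpsi i'.
    have [->|xe] := eqVneq x (e i'); first by rewrite mate_pole_e.
    have [->|xm] := eqVneq x (mate (G i') (e i')); first by rewrite mate_pole_me.
    by rewrite mate_pole //; apply: pm.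
- move=> [j|[[i' v]|k]] hv hvU.
  + by rewrite sum_hex //; apply: hd.
  + rewrite -/(pole_vertex v) in hv hvU *; rewrite mem_vset_pole in hv.
    case/andP: hv => vG vw; rewrite sum_pole //.
    by have [[_ _ p3] _ _ _] := hpsi i'; apply: p3; rewrite ?inE.
  + rewrite sum_new // -[RHS](Yc k) //; apply: eq_bigr => i' _ /=.
    by have [_ _ _ ->] := hpsi i'.
Qed.

Lemma no_colouring_off_new (U : {set VG}) Phi :
  (forall u, u \in U -> exists k, u = new_vertex k) -> ~ colouring_off Gam U Phi.
Proof.
move=> hU [Phi0 Phim Phis].
have hexU j : hex_vertex j \notin U by apply/negP=> /hU[].
have hd j : Phi (hex_end j false false) = Phi (hex_end j true true)
    + Phi (hex_end (ord_pred j) true true).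
  have h0 : hex_vertex j \in vset Gam by rewrite vset_Gam inE.
  have := Phis _ h0 (hexU j); rewrite sum_hex => /eqP; rewrite addc_eq0 => /eqP <-.
  congr (_ + _); rewrite -[in LHS](Phim (hex_end j true false)) ?mem_hex_end //.
  by rewrite mate_hex.
have flow i : Phi (hex_end (pole_index i false) false false)
    + Phi (hex_end (pole_index i true) false false) != 0.
  have [meG _ mme] := mateE (hG i) (he i).
  have spoke b : Phi (hex_end (pole_index i b) false false) =
      Phi (pole_end (if b then mate (G i) (e i) else e i)).
    by rewrite -mate_spoke Phim ?mem_hex_end.
  rewrite !spoke.
  have hpole : pole_colouring (G i) (e i) (w i) set0 (fun x => Phi (pole_end x)).
    split=> [x xG|x xG xe xm|v vG vw _].
    - by apply: Phi0; rewrite mem_pole_end.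
    - by rewrite -mate_pole // Phim ?mem_pole_end.
    - rewrite -sum_pole //; apply: Phis; first by rewrite mem_vset_pole vG.
      by apply/negP=> /hU[].
  exact: (pole_proper (hG i) (he i) (@hproper i) hpole).
pose i0 : 'I_3 := ord0; pose i1 : 'I_3 := ordS i0; pose i2 : 'I_3 := ordS i1.
have predE (i i' : 'I_3) (b b' : bool) :
    (i + 3 * b)%N = ((i' + 3 * b' + 6).-1 %% 6)%N -> ord_pred (pole_index i' b') = pole_index i b.
  by move=> E; apply: val_inj; rewrite /= !val_pole_index.
have p0f : ord_pred (pole_index i0 false) = pole_index i2 true by apply: predE.
have p1f : ord_pred (pole_index i1 false) = pole_index i0 false by apply: predE.
have p2f : ord_pred (pole_index i2 false) = pole_index i1 false by apply: predE.
have p0t : ord_pred (pole_index i0 true) = pole_index i2 false by apply: predE.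
have p1t : ord_pred (pole_index i1 true) = pole_index i0 true by apply: predE.
have p2t : ord_pred (pole_index i2 true) = pole_index i1 true by apply: predE.
(* The indices [i0], [i1], [i2] with [false] give the vertices 0, 1, 2, and with [true] the vertices
   3, 4, 5; so the values of [h] below run around the hexagon in the order expected by
   [hexagon_flow]. *)
pose h i b := Phi (hex_end (pole_index i b) true true).
have h_neq0 i b : h i b != 0 by apply: Phi0; rewrite mem_hex_end.
have d_neq0 i b : Phi (hex_end (pole_index i b) false false) != 0.
  by apply: Phi0; rewrite mem_hex_end.
have := hexagon_flow (And3 (h_neq0 i0 false) (h_neq0 i1 false) (h_neq0 i2 false))
  (And3 (h_neq0 i0 true) (h_neq0 i1 true) (h_neq0 i2 true)).
move: (flow i0) (flow i1) (flow i2).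
move: (d_neq0 i0 false) (d_neq0 i1 false) (d_neq0 i2 false).
move: (d_neq0 i0 true) (d_neq0 i1 true) (d_neq0 i2 true).
rewrite !hd p0f p1f p2f p0t p1t p2t -!/(h _ _).
move=> d0t d1t d2t d0f d1f d2f /negPf f0 /negPf f1 /negPf f2 contra.
by have := contra (And3 d0f d1f d2f) (And3 d0t d1t d2t); rewrite f0 f1 f2.
Qed.

(** * Removal of two adjacent vertices, by type of edge *)

Lemma off_hex_edge j :
  exists Phi, colouring_off Gam [set hex_vertex j; hex_vertex (ordS j)] Phi.
Proof.
have [h [d [h0 d0 hd F0 Fsum]]] := hex_adjacent j.
pose i : 'I_3 := ord0.
pose F := d (pole_index i false) + d (pole_index i true).
(* No pole is damaged, so pole 0 is chosen to start from; three ends of the same colour [F] have sum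
   [F]. *)
have [|||phi [p1 p2 p3 p4]] := @pole_completion i _ _ (fun=> F) (d0 (pole_index i false))
   (d0 (pole_index i true)).
- by move=> _; apply: F0.
- exact: F0.
- by rewrite !big_ord_recl big_ord0 addr0 addcc addr0.
apply: (assemble (i := i) (phi := phi) (h := h) (d := d)) => //.
- case: p1 => q1 q2 q3; split=> // v vG vw _; apply: q3 => //; by rewrite inE.
- move=> k; rewrite !inE negb_or => /andP[kj ksj]; apply: hd.
    by apply: contraNneq kj => ->.
  by apply: contraNneq ksj => ->.
- right; rewrite -[RHS]Fsum [RHS](bigD1 i) //=; congr (_ + _).
  rewrite sum_cut; under eq_bigr do rewrite p4.
  by rewrite !big_ord_recl big_ord0 addr0 addcc addr0.
Qed.

Lemma off_pole_edge i u v : critical (G i) -> adjacent (G i) u v -> u != v ->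
    u \in vset (G i) -> v \in vset (G i) -> u != w i -> v != w i ->
  exists Phi, colouring_off Gam [set pole_vertex u; pole_vertex v] Phi.
Proof.
move=> hc auv uv uG vG uw vw.
have [phi cphi] := critical_colouring_off (hG i) hc uG vG uv auv.
have [phi0 phim phis] := cphi.
have [h [d [h0 d0 hd dE [F0 Fsum]]]] := hex_equal_spokes i (phi0 _ (he i)).
apply: (assemble (i := i) (phi := phi) (h := h) (d := d)) => //.
- apply: colouring_off_pole cphi _ => x; rewrite !inE => /orP[]/eqP->;
    by rewrite eqxx ?orbT.
- by rewrite phim.
(* Kirchhoff's law still holds at [w i] in [G i], so pole [i] contributes no flow. *)
- right; rewrite phis ?add0r ?Fsum //.
  by rewrite !inE negb_or eq_sym uw eq_sym vw.
Qed.

(** In [G i] the new vertex [k] is replaced by [w i], so criticality is applied to the edge from [u]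
    to [w i]. The colours at [w i] may then have any sum, which the exempt column [k] absorbs. *)
Lemma off_cut_edge i k u : critical (G i) ->
    inc (G i) (mate (G i) (cut_at i k)) = Some u -> u != w i ->
  exists Phi, colouring_off Gam [set pole_vertex u; new_vertex k] Phi.
Proof.
move=> hc iu uw; have := cut_at_mem i k; rewrite inE => /andP[cG /eqP ic].
have [mcG _ mmc] := mateE (hG i) cG.
have uG : u \in vset (G i) by have [u'] := incP (hG i) mcG; rewrite iu => -[->].
have auw : adjacent (G i) u (w i).
  by apply/existsP; exists (mate (G i) (cut_at i k)); rewrite mcG mmc iu ic !eqxx.
have [phi cphi] := critical_colouring_off (hG i) hc uG (hw i) uw auw.
have [phi0 phim phis] := cphi.
have [h [d [h0 d0 hd dE [F0 Fsum]]]] := hex_equal_spokes i (phi0 _ (he i)).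
apply: (assemble (i := i) (phi := phi) (h := h) (d := d)) => //.
- apply: colouring_off_pole cphi _ => x; rewrite !inE => /orP[]/eqP->;
    by rewrite eqxx ?orbT.
- by rewrite phim.
- by left; exists k; rewrite !inE eqxx orbT.
Qed.

Lemma pole_colouring_mate i U phi :
  pole_colouring (G i) (mate (G i) (e i)) (w i) U phi ->
  pole_colouring (G i) (e i) (w i) U phi.
Proof.
have [_ _ mme] := mateE (hG i) (he i).
by case=> h1 h2 h3; split=> // x xG xe xm; apply: h2; rewrite ?mme.
Qed.

(** The order of choices matters: [delta] comes from the pole, the hexagon is then coloured with
    [delta] on the opposite spoke, and the resulting colour of the removed spoke is handed back to
    the pole as [c]. *)
Lemma off_spoke_edge i b u : good (G i) (e i) (w i) ->
    inc (G i) (if b then mate (G i) (e i) else e i) = Some u ->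
  exists Phi, colouring_off Gam [set hex_vertex (pole_index i b); pole_vertex u] Phi.
Proof.
move=> hgood; set x := (if b then _ else _) => iu.
have [meG _ mme] := mateE (hG i) (he i).
have [ew mew] := hew i.
have xG : x \in ends (G i) by rewrite /x; case: (b).
have imx : inc (G i) (mate (G i) x) <> Some (w i) by rewrite /x; case: (b); rewrite ?mme.
have uw : u != w i by apply/eqP=> uw; move: iu; rewrite uw /x; case: (b).
have [|delta hdelta] := good_colouring (hG i) (hw i) _ xG iu imx uw.
  move=> f g fG gG iF ig gf gmf; apply: hgood => //.
  by rewrite iF -iu /x; case: (b); rewrite eqxx ?orbT.
have pole_x U phi : pole_colouring (G i) x (w i) U phi ->
    pole_colouring (G i) (e i) (w i) U phi.
  by rewrite /x; case: (b) => //; apply: pole_colouring_mate.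
have delta0 : delta != 0.
  have [phi [[phi0 _ _] _ <- _]] := hdelta (1, 0) isT.
  by apply: phi0; have [] := mateE (hG i) xG.
have [h [d [h0 d0 hd dE [F0 Fsum]]]] := hex_one_defect i b delta0.
have [phi [hphi phix phimx sumphi]] := hdelta _ (d0 (pole_index i b)).
have phi_e : phi (e i) = d (pole_index i false) /\
    phi (mate (G i) (e i)) = d (pole_index i true).
  by move: phix phimx dE; rewrite /x; case: (b) => /= ->; rewrite ?mme => -> ->.
apply: (assemble (i := i) (phi := phi) (h := h) (d := d)) => //.
- have [q1 q2 q3] := pole_x _ _ hphi; split=> // v vG vw vU; apply: q3 => //.
  by apply: contra vU; rewrite !inE => /eqP->; rewrite eqxx orbT.
- by case: phi_e.
- by case: phi_e.
- move=> k; rewrite !inE negb_or => /andP[kj _]; apply: hd.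
  by apply: contraNneq kj => ->.
- by right; rewrite sumphi.
Qed.

Lemma critical_Gam : (forall i, critical (G i)) ->
  (forall i, good (G i) (e i) (w i)) -> critical Gam.
Proof.
move=> hc hgood u v uV vV uv /existsP[x /and3P[xE /eqP ix /eqP imx]].
have cGam := closed_cubic_Gam.
suff [Phi hPhi] : exists Phi, colouring_off Gam [set u; v] Phi.
  exact: colouring_off_edge_colourable hPhi.
move: x xE u v uV vV uv ix imx; apply: ends_GamP => [j b|j|i x xG] u v uV vV uv.
- rewrite mate_hex !inc_hex /= => -[<-] [<-].
  case: b; first exact: off_hex_edge.
  by rewrite setUC -{2}(ord_predK j); apply: off_hex_edge.
- have [i [b ->]] := pole_index_surj j.
  rewrite inc_hex mate_spoke => -[<-]; set y := (if b then _ else _).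
  have yG : y \in ends (G i).
    by rewrite /y; case: (b); have [] := mateE (hG i) (he i).
  have yw : y \notin ends_at (G i) (w i).
    by rewrite inE yG /y; have [/eqP h1 /eqP h2] := hew i; case: (b).
  case: (inc_poleP yG) => [[yw' _]|[t [iy _ _ ->]] [<-]]; first by rewrite yw' in yw.
  exact: off_spoke_edge.
- have [meG _ mme] := mateE (hG i) (he i).
  (* A spoke seen from its pole; the case seen from the hexagon, with the two vertices exchanged. *)
  have spoke b : x = (if b then mate (G i) (e i) else e i) ->
      inc Gam (pole_end x) = Some u -> inc Gam (mate Gam (pole_end x)) = Some v ->
      exists Phi, colouring_off Gam [set u; v] Phi.
    move=> xE; rewrite {2}xE mate_cut inc_hex => + [<-].
    case: (inc_poleP xG) => [[xw _]|[t [it _ _ ->]] [<-]].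
      move: xw; rewrite inE xE => /andP[_ /eqP]; have [h1 h2] := hew i.
      by case: (b).
    by rewrite setUC; apply: off_spoke_edge => //; rewrite -xE.
  have [xe|xe] := eqVneq x (e i); first exact: (spoke false).
  have [xm|xm] := eqVneq x (mate (G i) (e i)); first exact: (spoke true).
  rewrite mate_pole //; have [mxG _ mmx] := mateE (hG i) xG.
  have loop := snark_loopless (hG i) xG.
  case: (inc_poleP xG) => [[/cut_atP[k xk] _]|[a [ia aG aw ->]] [ua]].
    rewrite xk inc_cut_at => -[<-].
    case: (inc_poleP mxG) => [[mxw _]|[a [ia aG aw]]].
      move: mxw (cut_at_mem i k) loop; rewrite -xk !inE => /andP[_ /eqP->] /andP[_ /eqP->].
      by rewrite eqxx.
    rewrite xk => -> [<-]; rewrite setUC; apply: off_cut_edge => //.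
    by rewrite -xk.
  case: (inc_poleP mxG) => [[/cut_atP[k xk] _]|[a' [ia' aG' aw' ->]] [ua']].
    rewrite xk inc_cut_at -ua => -[<-]; apply: off_cut_edge => //.
    by rewrite -xk mmx.
  rewrite -ua -ua' in uv *; apply: off_pole_edge => //; last by apply: contraNneq uv => ->.
  by apply/existsP; exists x; rewrite xG ia ia' !eqxx.
Qed.

(** * Connectedness, chromatic index and failure of bicriticality *)

Lemma connected_Gam : connected Gam.
Proof.
have cGam := closed_cubic_Gam.
have adj x u v : x \in ends Gam -> inc Gam x = Some u -> inc Gam (mate Gam x) = Some v ->
    connect (adjacent Gam) u v.
  move=> xE ix imx; apply: connect1; apply/existsP; exists x.
  by rewrite xE ix imx !eqxx.
have csym : connect_sym (adjacent Gam) by exact/sym_connect_sym/closed_adjacent_sym.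
pose o := hex_vertex ord0.
have hexo j : connect (adjacent Gam) (hex_vertex j) o.
  rewrite csym -(inord_val j); elim: (val j) (ltn_ord j) => [|n IH] hn.
    by rewrite (_ : inord 0 = ord0) ?connect0 //; apply: val_inj; rewrite /= inordK.
  apply: connect_trans (IH (ltnW hn)) _.
  apply: (adj (hex_end (inord n) true true)); rewrite ?mem_hex_end // ?mate_hex inc_hex //=.
  congr (Some (hex_vertex _)); apply: val_inj.
  by rewrite /= !inordK ?modn_small // ltnW.
(* By [pole_reach] there is a path inside the pole to an endvertex of the cut edge, from which a
   spoke leads to the hexagon. *)
have poleo i v : v \in vset (G i) -> v != w i -> connect (adjacent Gam) (pole_vertex v) o.
  move=> vG vw; have [x [u [xe ix vu]]] :=
    pole_reach (hG i) (he i) (hw i) (hs i) (@hperfect i) vG vw.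
  have [b xb] : exists b, x = if b then mate (G i) (e i) else e i.
    by case: xe; [exists false|exists true].
  have uw : u != w i.
    by have [h1 h2] := hew i; apply/eqP=> uw; move: ix; rewrite uw xb; case: (b).
  have xG : x \in ends (G i) by rewrite xb; case: (b); have [] := mateE (hG i) (he i).
  have uo : connect (adjacent Gam) (pole_vertex u) o.
    apply: connect_trans (hexo (pole_index i b)).
    apply: (adj (pole_end x)); rewrite ?mem_pole_end ?(inc_pole ix) //.
    by rewrite xb mate_cut inc_hex.
  apply: connect_trans uo; case/connectP: vu => p hp ->.
  elim: p v hp {vG vw} => [|a p IH] v /=; first by rewrite connect0.
  case/andP=> /existsP[y /and5P[yG ye ym vw /and3P[aw /eqP iy /eqP imy]]] /IH.
  apply: connect_trans; apply: (adj (pole_end y)); rewrite ?mem_pole_end //.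
    exact: inc_pole.
  by rewrite mate_pole //; apply: inc_pole.
have all_o u : u \in vset Gam -> connect (adjacent Gam) u o.
  case: u => [j|[[i v]|k]] uV; first exact: hexo.
    by move: uV; rewrite -/(pole_vertex v) mem_vset_pole => /andP[]; apply: poleo.
  pose x := cut_at ord0 k; have xw := cut_at_mem ord0 k.
  have [xe xm] := ends_at_w_ne (hew ord0).1 (hew ord0).2 xw.
  move: xw; rewrite inE => /andP[xG /eqP ix].
  have [mxG _ _] := mateE (hG ord0) xG; have loop := snark_loopless (hG ord0) xG.
  have [v imx vG] := incP (hG ord0) mxG.
  have vw : v != w ord0 by move: loop; rewrite imx ix; apply: contra => /eqP->.
  apply: connect_trans (poleo _ _ vG vw); apply: (adj (pole_end x)).
  - by rewrite mem_pole_end.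
  - exact: inc_cut_at.
  - by rewrite mate_pole //; apply: inc_pole.
split.
  by apply/set0Pn; exists o; rewrite vset_Gam inE.
move=> u v uV vV; apply: connect_trans (all_o u uV) _; rewrite csym; exact: all_o.
Qed.

(* Starting from a colouring that fails Kirchhoff's law only at the vertices 0
   and 1 of the hexagon, recolour the three edges meeting edge 0 of the hexagon:
   the hexagon edges 5 and 1 get the fourth colour. *)
Lemma edge_colourable4_Gam : edge_colourable Gam 4.
Proof.
pose j0 : 'I_6 := inord 0; pose j1 : 'I_6 := inord 1.
pose j2 : 'I_6 := inord 2; pose j5 : 'I_6 := inord 5.
have Sj0 : ordS j0 = j1 by apply: val_inj; rewrite /= !inordK.
have pred_eq (j : 'I_6) m n : (m < 6)%N -> (n < 6)%N -> (m.+1 %% 6 = n)%N ->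
    (ord_pred j == inord m) = (j == inord n).
  move=> hm hn mn; have SE : ordS (inord m : 'I_6) = inord n.
    by apply: val_inj; rewrite /= !inordK.
  by apply/eqP/eqP => [E|->]; [rewrite -SE -E ord_predK|rewrite -SE ordSK].
have [Phi hPhi] := off_hex_edge j0; rewrite Sj0 in hPhi.
have [Phi0 Phim Phis] := hPhi.
(* The new colour of edge 0 has to avoid only the spokes at 0 and 1, because both neighbouring
   hexagon edges receive the fourth colour. *)
have [x0 [x0n x01 x02]] : exists x0 : colour, [/\ x0 != 0,
     x0 != Phi (hex_end j0 false false) & x0 != Phi (hex_end j1 false false)].
  move: (Phi _) (Phi _) => a b.
  have : has (fun x : colour => [&& x != 0, x != a & x != b]) [:: (1,0); (0,1); (1,1)].
    by case: a b => [[[|[|//]] ?] [[|[|//]] ?]] [[[|[|//]] ?] [[|[|//]] ?]].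
  by case/hasP=> x _ /and3P[]; exists x.
pose col j := if (j == j5) || (j == j1) then 3%N else
  if j == j0 then code x0 else code (Phi (hex_end j true true)).
pose c (x : DG) := if x is inl (j, (true, b)) then col (if b then j else ord_pred j)
  else code (Phi x).
have code_neq x y : x != 0 -> y != 0 -> x != y -> code x != code y.
  by move=> x_0 y_0; apply: contra => /eqP xy; rewrite -(codeK x_0) xy codeK.
have code_neq3 x : code x != 3%N by rewrite neq_ltn code_lt3.
have neq_code3 x : 3%N != code x by rewrite eq_sym.
have [n05 n01 n15 n25] : [/\ j0 != j5, j0 != j1, j1 != j5 & j2 != j5].
  by rewrite -!val_eqE /= !inordK.
have hPhi0 j b d : b || ~~ d -> Phi (hex_end j b d) != 0.
  by move=> bd; apply: Phi0; rewrite mem_hex_end.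
have hexc j : [/\ col j != col (ord_pred j), col j != code (Phi (hex_end j false false))
     & col (ord_pred j) != code (Phi (hex_end j false false))].
  rewrite /col /j5 /j1 /j0 (pred_eq j 5 0)%N // (pred_eq j 1 2)%N // (pred_eq j 0 1)%N //.
  rewrite -/j0 -/j1 -/j2 -/j5.
  have [->|nj0] := eqVneq j j0.
    rewrite (negPf n05) (negPf n01) /=; split=> //; apply: code_neq => //; exact: hPhi0.
  have [->|nj1] := eqVneq j j1.
    rewrite orbT orFb (_ : (j1 == j2) = false); last by rewrite -val_eqE /= !inordK.
    split=> //; apply: code_neq => //; exact: hPhi0.
  rewrite orFb !orbF.
  have pE : Phi (hex_end (ord_pred j) true true) = Phi (hex_end j true false).
    by rewrite -[RHS]Phim ?mem_hex_end // mate_hex.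
  have jV : hex_vertex j \in vset Gam by rewrite vset_Gam inE.
  have jU : hex_vertex j \notin [set hex_vertex j0; hex_vertex j1].
    by rewrite !inE negb_or; apply/andP; split; [move: nj0|move: nj1];
      apply: contra => /eqP[->].
  have [_ _ _ cub] := closed_cubic_Gam.
  have inj := sum_eq0_injective (cub _ jV) _ (Phis _ jV jU).
  have {}inj : {in ends_at Gam (hex_vertex j) &, injective Phi}.
    by apply: inj => x /[!inE] /andP[xE _]; apply: Phi0.
  have mem b d : b || ~~ d -> hex_end j b d \in ends_at Gam (hex_vertex j).
    by move=> bd; rewrite inE mem_hex_end bd inc_hex; case: b d bd => [] [] // _; rewrite eqxx.
  have neq b d b' d' : b || ~~ d -> b' || ~~ d' -> (b, d) != (b', d') ->
      code (Phi (hex_end j b d)) != code (Phi (hex_end j b' d')).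
    move=> bd bd' n; apply: code_neq; rewrite ?hPhi0 // (inj_in_eq inj) ?mem //.
    by apply: contra n => /eqP[-> ->].
  (* Among the vertices where Kirchhoff's law holds, only 5 and 2 meet a recoloured edge, one each,
     and there the fourth colour cannot clash with the two old ones. *)
  rewrite pE; have [jE|nj5] := eqVneq j j5.
    rewrite (_ : (j == j2) = false); last by rewrite jE eq_sym (negPf n25).
    by split=> //; apply: neq.
  by case: ifP => _; split=> //; apply: neq.
exists c; split.
- apply: ends_GamP => [j b|j|i x xG] /=; last 2 first.
  + exact: leq_trans (code_lt3 _) _.
  + exact: leq_trans (code_lt3 _) _.
  rewrite /col; case: ifP => // _; case: ifP => _; exact: leq_trans (code_lt3 _) _.
- have cE x : (forall j b, x <> hex_end j true b) -> c x = code (Phi x).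
    by case: x => [[j [[] b]]|z] // /(_ j b) [].
  apply: ends_GamP => [j b|j|i x xG].
  + by rewrite mate_hex /=; case: b => //=; rewrite ordSK.
  + have [i [b ->]] := pole_index_surj j.
    by rewrite !cE ?Phim ?mem_hex_end // => ? ?; rewrite ?mate_spoke.
  + have mcE : forall j b, mate Gam (pole_end x) <> hex_end j true b.
      move=> j b; have [->|xe] := eqVneq x (e i); first by rewrite mate_pole_e.
      have [->|xm] := eqVneq x (mate (G i) (e i)); first by rewrite mate_pole_me.
      by rewrite mate_pole.
    by rewrite !cE ?Phim ?mem_pole_end.
move=> v x y xv yv.
have [mG vG iG cub] := closed_cubic_Gam.
have vV : v \in vset Gam by move: xv; rewrite inE => /andP[xE /eqP]; apply: vG.
case: v xv yv vV => [j|u] xv yv vV.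
  have [n1 n2 n3] := hexc j; move: xv yv; rewrite -/(hex_vertex j) ends_at_hex.
  rewrite !inE => /orP[/orP[]|] /eqP-> /orP[/orP[]|] /eqP-> //= E; exfalso;
    by move: n1 n2 n3; rewrite ?E ?eqxx // -?E ?eqxx.
have cE z : z \in ends_at Gam (inr u) -> c z = code (Phi z) /\ Phi z != 0.
  rewrite inE => /andP[zE /eqP iz]; split; last exact: Phi0.
  by case: z zE iz => [[j [[] b]]|z] //= _; rewrite -/(hex_end j true b) inc_hex.
have [[-> x0'] [-> y0']] := (cE x xv, cE y yv).
move/(congr1 decode); rewrite !codeK //.
apply: (sum_eq0_injective (cub _ vV)) xv yv; first by move=> z /cE[].
by apply: Phis => //; rewrite !inE.
Qed.

Lemma snark_Gam : snark Gam.
Proof.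
have [mG vG iG cub] := closed_cubic_Gam.
have se0 : semiedges Gam = set0.
  by apply/setP=> x; rewrite !inE; apply/negP=> /andP[/iG/negPf->].
split=> //.
- split=> //; rewrite conns_Gam // => x.
  by rewrite se0 inE.
- exact: connected_Gam.
split; first exact: edge_colourable4_Gam.
move=> n n4 [c [c1 c2 c3]].
(* An edge colouring with fewer than four colours becomes a colouring with the empty set of
   defects. *)
have : edge_colourable (del_vertices Gam set0) 3.
  exists c; split=> [x|x|v x y]; rewrite !inE.
  - by move=> /and3P[xE _ _]; apply: leq_trans (c1 _ xE) _.
  - by move=> /and3P[xE _ _]; apply: c2.
  - move=> /andP[/and3P[xE _ _] ix] /andP[/and3P[yE _ _] iy].
    by apply: (c3 v); rewrite inE ?xE ?yE.
case/(edge_colourable_colouring_off closed_cubic_Gam) => Phi.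
by apply: no_colouring_off_new => u; rewrite inE.
Qed.

Lemma not_bicritical_Gam : ~ bicritical Gam.
Proof.
move=> /(_ (new_vertex ord0) (new_vertex ord_max)); rewrite vset_Gam !inE.
move=> /(_ isT isT isT) /(edge_colourable_colouring_off closed_cubic_Gam)[Phi].
by apply: no_colouring_off_new => u; rewrite !inE => /orP[]/eqP->; eexists.
Qed.

End Graph.

Theorem theorem4 (V D : 'I_3 -> finType) (G : forall i, multipole (V i) (D i))
    (e : forall i, D i) (w : forall i, V i) (s : forall i, seq (D i))
    (hG : forall i, critical_snark (G i))
    (he : forall i, e i \in ends (G i))
    (hw : forall i, w i \in vset (G i))
    (hew : forall i, inc (G i) (e i) <> Some (w i) /\
                     inc (G i) (mate (G i) (e i)) <> Some (w i))
    (hs : forall i, perm_eq (s i) (enum (ends_at (G i) (w i))))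
    (hproper : forall i, proper_pole (pole23 (G i) (e i) (w i) (s i)))
    (hperfect : forall i, perfect (pole23 (G i) (e i) (w i) (s i)))
    (hgood : forall i, good (G i) (e i) (w i)) :
  strictly_critical_snark
    (compose H6 (TTTsc (fun i => pole23 (G i) (e i) (w i) (s i)))).
Proof.
have hsn i := (hG i).1; have hcr i := (hG i).2.
split.
- exact: (snark_Gam hsn he hw hew hs hproper hperfect).
- exact: (critical_Gam hsn he hw hew hs hperfect hcr hgood).
- exact: (not_bicritical_Gam hsn he hw hs hproper).
Qed.
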